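(* Let $R$ be a commutative artin ring, $\mathcal{C}$ a dualizing $R$-variety and $P=\mathrm{Hom}_{\mathcal{C}}(C,-)\in\mathrm{mod}(\mathcal{C})$. The following are equivalent. (a) $\mathbb{I}_{1}=\mathbb{I}_{\infty}$. (b) $P\otimes_{R_{P}}\mathrm{Hom}_{\mathrm{Mod}(\mathcal{C})}(P,\mathrm{Hom}_{\mathcal{C}}(C',-))$ is a projective $\mathcal{C}$-module for all $C'\in\mathcal{C}$.
   Context: A Hom-finite $R$-variety is a small additive category in which idempotents split, whose Hom-sets are finitely generated $R$-modules with $R$-bilinear composition. $\mathrm{Mod}(\mathcal{C})$ is the category of additive functors $\mathcal{C}\to\mathbf{Ab}$ ($\mathcal{C}$-modules) and $\mathrm{mod}(\mathcal{C})$ its full subcategory of finitely presented functors. With $E$ the injective envelope of $R/\mathrm{rad}(R)$, put $\mathbb{D}_{\mathcal{C}}(M)(X)=\mathrm{Hom}_R(M(X),E)$ for functors with finitely generated values; $\mathcal{C}$ is dualizing if $\mathbb{D}_{\mathcal{C}}$ induces a duality between $\mathrm{mod}(\mathcal{C})$ and $\mathrm{mod}(\mathcal{C}^{op})$. $R_P=\mathrm{End}_{\mathrm{mod}(\mathcal{C})}(P)^{op}$, and for a left $R_P$-module $N$, $P\otimes_{R_P}N\in\mathrm{Mod}(\mathcal{C})$ is $(P\otimes_{R_P}N)(X)=P(X)\otimes_{R_P}N$. $J=I_0(P/\mathrm{rad}(P))$ is the injective envelope of $P/\mathrm{rad}(P)$ in $\mathrm{mod}(\mathcal{C})$, where $\mathrm{rad}(P)$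 is the intersection of the maximal submodules, and $\mathrm{add}(J)$ is the class of direct summands of finite direct sums of copies of $J$. For $0\leq k\leq\infty$, $\mathbb{I}_k$ is the full subcategory of $\mathrm{mod}(\mathcal{C})$ of those $Y$ having an injective coresolution $0\to Y\to J_0\to J_1\to\cdots$ with $J_i\in\mathrm{add}(J)$ for $0\leq i\leq k$ (all $i\ge0$ if $k=\infty$). *)

(* Defs.v *)
From HB Require Import structures.
From mathcomp Require Import all_boot all_algebra.
From mathcomp Require Import boolp.
From mathcomp.multinomials Require Import freeg.

Set Implicit Arguments.
Unset Strict Implicit.
Unset Printing Implicit Defensive.

Import GRing.Theory.
Local Open Scope ring_scope.
Local Open Scope quotient_scope.

Section RingModules.
Variable R : pzRingType.
Implicit Types V W : lmodType R.

Definition fin_gen V : Prop :=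
  exists (n : nat) (g : 'I_n -> V),
    forall v, exists c : 'I_n -> R, v = \sum_(i < n) c i *: g i.

(* Submodules are boolean predicates; since boolp makes every proposition
   decidable this is no restriction. *)
Definition maximal_submod V (S : {pred V}) : Prop :=
  [/\ submod_closed S,
      exists v, v \notin S &
      forall T : {pred V}, submod_closed T -> {subset S <= T} ->
        {subset T <= S} \/ forall v, v \in T].

Definition mod_rad V : {pred V} :=
  [pred v | `[< forall S : {pred V}, maximal_submod S -> v \in S >]].

Lemma mod_rad_submod_closed V : submod_closed (@mod_rad V).
Proof.
split=> [|a u v]; first by rewrite inE; apply/asboolP => S [[]].
rewrite !inE => /asboolP ru /asboolP rv; apply/asboolP => S mS.
by case: (mS) => -[_ lS] _ _; apply: lS; [apply: ru|apply: rv].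
Qed.

HB.instance Definition _ V :=
  GRing.isSubmodClosed.Build R V (@mod_rad V)
    (GRing.submod_closed_semi (@mod_rad_submod_closed V)).

Definition mod_top V : Type := Quotient.quot (@mod_rad V).
HB.instance Definition _ V := GRing.Zmodule.on (mod_top V).

Section TopScale.
Variable V : lmodType R.
Let p (v : V) : mod_top V := \pi_(Quotient.quot (@mod_rad V)) v.

Definition mod_top_scale (a : R) (q : mod_top V) : mod_top V :=
  p (a *: repr (q : Quotient.quot (@mod_rad V))).

Let pB : {morph p : u v / u - v}.
Proof. by move=> u v; rewrite /p raddfB. Qed.

Let peq u v : u - v \in @mod_rad V -> p u = p v.
Proof. by move=> uv; apply/eqP; rewrite /p -Quotient.idealrBE. Qed.

Let scaleE a v : mod_top_scale a (p v) = p (a *: v).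
Proof.
apply: peq; rewrite -scalerBr; apply: rpredZ.
by rewrite Quotient.idealrBE reprK.
Qed.

Let pK (q : mod_top V) : exists v, q = p v.
Proof. by exists (repr (q : Quotient.quot (@mod_rad V))); rewrite /p reprK. Qed.

Let pD : {morph p : u v / u + v}.
Proof. by move=> u v; rewrite /p raddfD. Qed.

Let top_scaleA a b q :
  mod_top_scale a (mod_top_scale b q) = mod_top_scale (a * b) q.
Proof. by case: (pK q) => v ->; rewrite !scaleE scalerA. Qed.
Let top_scale1 : left_id 1 mod_top_scale.
Proof. by move=> q; case: (pK q) => v ->; rewrite scaleE scale1r. Qed.
Let top_scaleDr : right_distributive mod_top_scale +%R.
Proof.
move=> a q q'; case: (pK q) (pK q') => v -> [w ->].
by rewrite -pD !scaleE scalerDr pD.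
Qed.
Let top_scaleDl q : {morph mod_top_scale^~ q : a b / a + b}.
Proof. by move=> a b; case: (pK q) => v ->; rewrite !scaleE scalerDl pD. Qed.

HB.instance Definition _ := GRing.Zmodule_isLmodule.Build R (mod_top V)
  top_scaleA top_scale1 top_scaleDr top_scaleDl.
End TopScale.

Definition injective_module V : Prop :=
  forall (A B : lmodType R) (i : {linear A -> B}) (g : {linear A -> V}),
    injective i -> exists h : {linear B -> V}, forall a, h (i a) = g a.

Definition essential_mono V W (i : {linear V -> W}) : Prop :=
  injective i /\
  forall (B : lmodType R) (h : {linear W -> B}),
    injective (h \o i) -> injective h.

Definition injective_envelope V W : Prop :=
  injective_module W /\ exists i : {linear V -> W}, essential_mono i.

End RingModules.

(* For R commutative, the ideals of R are the submodules of R^o. *)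
Definition artinian (R : comPzRingType) : Prop :=
  forall I : nat -> {pred R^o},
    (forall n, submod_closed (I n)) ->
    (forall n, {subset I n.+1 <= I n}) ->
    exists n, forall m, (n <= m)%N -> I m =i I n.

(* A right S-module is a left module over the converse ring S^c. *)
Section Tensor.
Variables (S : pzRingType) (M : lmodType S^c) (N : lmodType S).

Definition tensor_free : Type := {freeg (M * N)%type}.
HB.instance Definition _ := GRing.Zmodule.on tensor_free.

Inductive tensor_rel : tensor_free -> Prop :=
| TensorDl x x' y : tensor_rel (<< (x + x', y) >> - << (x, y) >> - << (x', y) >>)
| TensorDr x y y' : tensor_rel (<< (x, y + y') >> - << (x, y) >> - << (x, y') >>)
| TensorZ (s : S) x y :
    tensor_rel (<< ((s : S^c) *: x, y) >> - << (x, s *: y) >>).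

(* the subgroup generated by tensor_rel *)
Definition tensor_ker : {pred tensor_free} :=
  [pred z | `[< forall K : {pred tensor_free}, zmod_closed K ->
                 (forall r, tensor_rel r -> r \in K) -> z \in K >]].

Lemma tensor_ker_zmod_closed : zmod_closed tensor_ker.
Proof.
split=> [|u v]; first by rewrite inE; apply/asboolP => K [].
rewrite !inE => /asboolP Ku /asboolP Kv; apply/asboolP => K zK rK.
by case: (zK) => _; apply; [apply: Ku|apply: Kv].
Qed.

HB.instance Definition _ :=
  GRing.isZmodClosed.Build tensor_free tensor_ker tensor_ker_zmod_closed.

Definition tensor : Type := Quotient.quot tensor_ker.
HB.instance Definition _ := GRing.Zmodule.on tensor.

Definition tens (x : M) (y : N) : tensor :=
  \pi_(Quotient.quot tensor_ker) (<< (x, y) >> : tensor_free).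

Lemma tens_rel (z z' : tensor_free) : tensor_rel (z - z') ->
  \pi_(Quotient.quot tensor_ker) z = \pi_(Quotient.quot tensor_ker) z'.
Proof.
move=> zz'; apply/eqP; rewrite -Quotient.idealrBE unfold_in.
by apply/asboolP => K _; apply.
Qed.

Lemma tensDl x x' y : tens (x + x') y = tens x y + tens x' y.
Proof.
rewrite /tens -[RHS]raddfD; apply: tens_rel.
by rewrite opprD addrA; apply: TensorDl.
Qed.

Lemma tensDr x y y' : tens x (y + y') = tens x y + tens x y'.
Proof.
rewrite /tens -[RHS]raddfD; apply: tens_rel.
by rewrite opprD addrA; apply: TensorDr.
Qed.

Lemma tensZ (s : S) x y : tens ((s : S^c) *: x) y = tens x (s *: y).
Proof. by apply: tens_rel; apply: TensorZ. Qed.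

Lemma tensor_ext (V : zmodType) (f g : {additive tensor -> V}) :
  (forall x y, f (tens x y) = g (tens x y)) -> f =1 g.
Proof.
move=> fg t; have [z ->] : exists z : tensor_free,
    t = \pi_(Quotient.quot tensor_ker) z.
  by exists (repr (t : Quotient.quot tensor_ker)); rewrite reprK.
rewrite -[z]freeg_sumE; elim: (dom _) => [|[x y] s IHs].
  by rewrite big_nil !raddf0.
rewrite big_cons !raddfD /= IHs; congr (_ + _).
have -> (k : int) : << k *g (x, y) >> = (<< (x, y) >> : tensor_free) *~ k.
  by rewrite freegU_mulz intz.
by rewrite !raddfMz; congr (_ *~ _); apply: fg.
Qed.

Section Lift.
Variables (V : zmodType) (b : M -> N -> V).
Hypothesis bDl : forall x x' y, b (x + x') y = b x y + b x' y.
Hypothesis bDr : forall x y y', b x (y + y') = b x y + b x y'.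
Hypothesis bZ : forall (s : S) x y, b ((s : S^c) *: x) y = b x (s *: y).

Definition free_lift : tensor_free -> V :=
  fglift (fun p : M * N => b p.1 p.2 : zmodule V).

Lemma free_lift_zmod_morphism : zmod_morphism free_lift.
Proof. exact: (@lift_is_additive int (M * N)%type (zmodule V)). Qed.

HB.instance Definition _ :=
  GRing.isZmodMorphism.Build tensor_free V free_lift free_lift_zmod_morphism.

Lemma free_liftU x y : free_lift << (x, y) >> = b x y.
Proof. by rewrite /free_lift liftU scale1r. Qed.

Lemma free_lift_ker (z : tensor_free) : z \in tensor_ker -> free_lift z = 0.
Proof.
rewrite inE => /asboolP Kz; apply/eqP.
apply: (Kz (fun u => free_lift u == 0)).
  split=> [|u v]; first by rewrite unfold_in raddf0.
  by rewrite !unfold_in => /eqP u0 /eqP v0; rewrite raddfB /= u0 v0 subr0.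
move=> _ [x x' y|x y y'|s x y]; rewrite unfold_in !raddfB /= !free_liftU.
- by rewrite bDl addrAC addrK subrr.
- by rewrite bDr addrAC addrK subrr.
- by rewrite bZ subrr.
Qed.

Definition tensor_lift_fun (t : tensor) : V :=
  free_lift (repr (t : Quotient.quot tensor_ker)).

Lemma tensor_lift_pi (z : tensor_free) :
  tensor_lift_fun (\pi_(Quotient.quot tensor_ker) z) = free_lift z.
Proof.
apply/eqP; rewrite /tensor_lift_fun -subr_eq0 -raddfB; apply/eqP/free_lift_ker.
by rewrite Quotient.idealrBE reprK.
Qed.

Lemma tensor_liftE x y : tensor_lift_fun (tens x y) = b x y.
Proof. by rewrite tensor_lift_pi free_liftU. Qed.

Lemma tensor_lift_zmod_morphism : zmod_morphism tensor_lift_fun.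
Proof.
move=> u v; rewrite -[u]reprK -[v]reprK -raddfB !tensor_lift_pi; exact: raddfB.
Qed.

HB.instance Definition _ :=
  GRing.isZmodMorphism.Build tensor V tensor_lift_fun tensor_lift_zmod_morphism.

Definition tensor_lift : {additive tensor -> V} := tensor_lift_fun.
End Lift.

End Tensor.

(* ccomp g f is g after f *)
Record lincat (R : comPzRingType) := LinCat {
  obj :> Type;
  hom : obj -> obj -> lmodType R;
  idm : forall X, hom X X;
  ccomp : forall X Y Z, hom Y Z -> hom X Y -> hom X Z;
  ccomp_linl : forall X Y Z (f : hom X Y), linear (fun g : hom Y Z => ccomp g f);
  ccomp_linr : forall X Y Z (g : hom Y Z), linear (fun f : hom X Y => ccomp g f);
  ccompA : forall X Y Z W (h : hom Z W) (g : hom Y Z) (f : hom X Y),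
    ccomp h (ccomp g f) = ccomp (ccomp h g) f;
  ccomp1m : forall X Y (f : hom X Y), ccomp (idm Y) f = f;
  ccompm1 : forall X Y (f : hom X Y), ccomp f (idm X) = f
}.
Arguments hom {R C} X Y : rename.
Arguments idm {R C} X : rename.
Arguments ccomp {R C X Y Z} g f : rename.

Definition opcat (R : comPzRingType) (C : lincat R) : lincat R :=
  @LinCat R C (fun X Y => @hom R C Y X) (fun X => idm X)
    (fun X Y Z g f => ccomp f g)
    (fun X Y Z f => ccomp_linr f) (fun X Y Z g => ccomp_linl g)
    (fun X Y Z W h g f => esym (ccompA f g h))
    (fun X Y f => ccompm1 f) (fun X Y f => ccomp1m f).

Section Varieties.
Variables (R : comPzRingType) (C : lincat R).

(* an object is a zero object iff its identity is 0 *)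
Definition has_zero : Prop := exists Z : C, idm Z = 0.

Definition is_biproduct (X Y W : C) : Prop :=
  exists (i1 : hom X W) (i2 : hom Y W) (p1 : hom W X) (p2 : hom W Y),
    [/\ ccomp p1 i1 = idm X, ccomp p2 i2 = idm Y, ccomp p1 i2 = 0, ccomp p2 i1 = 0 &
        ccomp i1 p1 + ccomp i2 p2 = idm W].

Definition additive_category : Prop :=
  has_zero /\ forall X Y : C, exists W, is_biproduct X Y W.

Definition idempotents_split : Prop :=
  forall (X : C) (e : hom X X), ccomp e e = e ->
    exists (Y : C) (r : hom X Y) (s : hom Y X),
      ccomp s r = e /\ ccomp r s = idm Y.

Definition hom_finite_variety : Prop :=
  [/\ additive_category, idempotents_split & forall X Y : C, fin_gen (hom X Y)].

End Varieties.

Record cmod (R : comPzRingType) (C : lincat R) := CMod {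
  fob :> C -> zmodType;
  fmor : forall X Y : C, hom X Y -> {additive fob X -> fob Y};
  fmorD : forall (X Y : C) (f g : hom X Y) x,
    fmor (f + g) x = fmor f x + fmor g x;
  fmor1 : forall (X : C) x, fmor (idm X) x = x;
  fmorM : forall (X Y Z : C) (g : hom Y Z) (f : hom X Y) x,
    fmor (ccomp g f) x = fmor g (fmor f x)
}.
Arguments fmor {R C} M {X Y} f : rename.

Record natt (R : comPzRingType) (C : lincat R) (M N : cmod C) := Natt {
  ntapp :> forall X : C, {additive M X -> N X};
  ntnat : forall (X Y : C) (f : hom X Y) x,
    ntapp Y (fmor M f x) = fmor N f (ntapp X x)
}.

Section Natt.
Variables (R : comPzRingType) (C : lincat R).
Implicit Types M N L : cmod C.

Lemma additive_eq (U V : zmodType) (f g : {additive U -> V}) : f =1 g -> f = g.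
Proof.
case: f g => [f [[hf]]] [g [[hg]]] /= /funext fg; rewrite -{}fg in hg *.
by rewrite (Prop_irrelevance hf hg).
Qed.

Lemma natt_eq M N (f g : natt M N) : (forall X x, f X x = g X x) -> f = g.
Proof.
case: f g => [f hf] [g hg] /= fg.
have efg : f = g.
  by apply: functional_extensionality_dep => X; exact: additive_eq (fg X).
by case: _ / efg hg {fg} => hg; rewrite (Prop_irrelevance hf hg).
Qed.

HB.instance Definition _ M N := gen_eqMixin (natt M N).
HB.instance Definition _ M N := gen_choiceMixin (natt M N).

Section Zmodule.
Variables M N : cmod C.

Definition natt0 : natt M N.
Proof. by exists (fun X => \0) => X Y f x /=; rewrite raddf0. Defined.

Definition natt_add (a b : natt M N) : natt M N.
Proof.
by exists (fun X => a X \+ b X) => X Y f x /=; rewrite !ntnat raddfD.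
Defined.

Definition natt_opp (a : natt M N) : natt M N.
Proof. by exists (fun X => \- a X) => X Y f x /=; rewrite !ntnat raddfN. Defined.

Let addA : associative natt_add.
Proof. by move=> a b c; apply: natt_eq => X x /=; rewrite addrA. Qed.
Let addC : commutative natt_add.
Proof. by move=> a b; apply: natt_eq => X x /=; rewrite addrC. Qed.
Let add0 : left_id natt0 natt_add.
Proof. by move=> a; apply: natt_eq => X x /=; rewrite add0r. Qed.
Let addN : left_inverse natt0 natt_opp natt_add.
Proof. by move=> a; apply: natt_eq => X x /=; rewrite addNr. Qed.

HB.instance Definition _ :=
  GRing.isZmodule.Build (natt M N) addA addC add0 addN.
End Zmodule.

Definition natt_id M : natt M M.
Proof. by exists (fun X => idfun). Defined.

Definition natt_comp M N L (b : natt N L) (a : natt M N) : natt M L.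
Proof. by exists (fun X => b X \o a X) => X Y f x /=; rewrite !ntnat. Defined.

Definition niso M N : Prop :=
  exists (a : natt M N) (b : natt N M),
    natt_comp b a = natt_id M /\ natt_comp a b = natt_id N.

Definition nmono M N (a : natt M N) : Prop := forall X, injective (a X).
Definition nepi M N (a : natt M N) : Prop := forall X y, exists x, a X x = y.
Definition nexact M N L (a : natt M N) (b : natt N L) : Prop :=
  forall X y, b X y = 0 <-> exists x, a X x = y.

End Natt.

Section Endomorphisms.
Variables (R : comPzRingType) (C : lincat R) (M : cmod C).

Definition endo : Type := natt M M.
HB.instance Definition _ := GRing.Zmodule.on endo.

Let mulA : associative (fun a b : endo => natt_comp a b).
Proof. by move=> a b c; apply: natt_eq. Qed.
Let mul1 : left_id (natt_id M) (fun a b : endo => natt_comp a b).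
Proof. by move=> a; apply: natt_eq. Qed.
Let mulr1 : right_id (natt_id M) (fun a b : endo => natt_comp a b).
Proof. by move=> a; apply: natt_eq. Qed.
Let mulDl : left_distributive (fun a b : endo => natt_comp a b) +%R.
Proof. by move=> a b c; apply: natt_eq. Qed.
Let mulDr : right_distributive (fun a b : endo => natt_comp a b) +%R.
Proof. by move=> a b c; apply: natt_eq => X x /=; rewrite raddfD. Qed.

HB.instance Definition _ :=
  GRing.Zmodule_isPzRing.Build endo mulA mul1 mulr1 mulDl mulDr.

End Endomorphisms.

(* R_P = End(P)^op *)
Definition endop (R : comPzRingType) (C : lincat R) (P : cmod C) : pzRingType :=
  (endo P)^c.

Section Actions.
Variables (R : comPzRingType) (C : lincat R) (P : cmod C).

(* Hom(P, M) as a left R_P-module, by precomposition *)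
Section LeftHom.
Variable M : cmod C.
Definition lhom : Type := natt P M.
HB.instance Definition _ := GRing.Zmodule.on lhom.

Definition lhom_scale (f : endop P) (h : lhom) : lhom := natt_comp h (f : endo P).

Let scaleA f g h : lhom_scale f (lhom_scale g h) = lhom_scale (f * g) h.
Proof. exact: natt_eq. Qed.
Let scale1 : left_id 1 lhom_scale.
Proof. by move=> h; apply: natt_eq. Qed.
Let scaleDr : right_distributive lhom_scale +%R.
Proof. by move=> f h h'; apply: natt_eq. Qed.
Let scaleDl h : {morph lhom_scale^~ h : f g / f + g}.
Proof. by move=> f g; apply: natt_eq => X x /=; rewrite raddfD. Qed.

HB.instance Definition _ := GRing.Zmodule_isLmodule.Build (endop P) lhom
  scaleA scale1 scaleDr scaleDl.
End LeftHom.

(* P(X) as a right R_P-module, by evaluation *)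
Section RightEval.
Variable X : C.
Definition reval : Type := P X.
HB.instance Definition _ := GRing.Zmodule.on reval.

Definition reval_scale (f : (endop P)^c) (x : reval) : reval := (f : endo P) X x.

Let scaleA f g x : reval_scale f (reval_scale g x) = reval_scale (f * g) x.
Proof. by []. Qed.
Let scale1 : left_id 1 reval_scale.
Proof. by []. Qed.
Let scaleDr : right_distributive reval_scale +%R.
Proof. by move=> f x y; rewrite /reval_scale raddfD. Qed.
Let scaleDl x : {morph reval_scale^~ x : f g / f + g}.
Proof. by []. Qed.

HB.instance Definition _ := GRing.Zmodule_isLmodule.Build (endop P)^c reval
  scaleA scale1 scaleDr scaleDl.
End RightEval.

Section TensorFunctor.
Variable N : lmodType (endop P).

Definition ften (X : C) : zmodType := tensor (reval X) N.

Section Mor.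
Variables (X Y : C) (f : hom X Y).
Let b (x : reval X) (n : N) : ften Y := tens (fmor P f x : reval Y) n.
Let bDl x x' n : b (x + x') n = b x n + b x' n.
Proof. by rewrite /b raddfD tensDl. Qed.
Let bDr x n n' : b x (n + n') = b x n + b x n'.
Proof. exact: tensDr. Qed.
Let bZ (s : endop P) x n : b ((s : (endop P)^c) *: x) n = b x (s *: n).
Proof. by rewrite /b -tensZ; congr tens; symmetry; apply: ntnat. Qed.

Definition ften_mor : {additive ften X -> ften Y} := tensor_lift bDl bDr bZ.

Lemma ften_morE (x : P X) (n : N) :
  ften_mor (tens (x : reval X) n) = tens (fmor P f x : reval Y) n.
Proof. exact: tensor_liftE. Qed.
End Mor.

Lemma ften_morD (X Y : C) (f g : hom X Y) x :
  ften_mor (f + g) x = ften_mor f x + ften_mor g x.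
Proof.
apply: (tensor_ext (g := ften_mor f \+ ften_mor g)) => {}x n /=.
by rewrite !ften_morE fmorD -tensDl.
Qed.

Lemma ften_mor1 (X : C) x : ften_mor (idm X) x = x.
Proof.
by apply: (tensor_ext (g := idfun)) => {}x n /=; rewrite ften_morE fmor1.
Qed.

Lemma ften_morM (X Y Z : C) (g : hom Y Z) (f : hom X Y) x :
  ften_mor (ccomp g f) x = ften_mor g (ften_mor f x).
Proof.
apply: (tensor_ext (g := ften_mor g \o ften_mor f)) => {}x n /=.
by rewrite !ften_morE fmorM.
Qed.

Definition ntensor : cmod C := CMod ften_morD ften_mor1 ften_morM.

End TensorFunctor.
End Actions.

Section Representable.
Variables (R : comPzRingType) (C : lincat R) (X : C).

Section Mor.
Variables (Y Z : C) (f : hom Y Z).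
Definition yon_fun (g : hom X Y) : hom X Z := ccomp f g.
Lemma yon_fun_zmod_morphism : zmod_morphism yon_fun.
Proof. exact: zmod_morphism_linear (ccomp_linr f). Qed.
HB.instance Definition _ :=
  GRing.isZmodMorphism.Build (hom X Y) (hom X Z) yon_fun yon_fun_zmod_morphism.
Definition yon_mor : {additive hom X Y -> hom X Z} := yon_fun.
End Mor.

Lemma yon_morD (Y Z : C) (f g : hom Y Z) x :
  yon_mor (f + g) x = yon_mor f x + yon_mor g x.
Proof. by have := ccomp_linl x 1 f g; rewrite !scale1r. Qed.

Definition yon : cmod C :=
  @CMod R C (fun Y => hom X Y) yon_mor yon_morD
    (fun Y f => ccomp1m f) (fun Y Z W g f x => esym (ccompA g f x)).

End Representable.

Section DirectSums.
Variables (R : comPzRingType) (C : lincat R).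

Section Sum.
Variables M N : cmod C.

Section Mor.
Variables (X Y : C) (f : hom X Y).
Definition nsum_fun (p : M X * N X) : M Y * N Y := (fmor M f p.1, fmor N f p.2).
Lemma nsum_fun_zmod_morphism : zmod_morphism nsum_fun.
Proof. by move=> p q; rewrite /nsum_fun !raddfB. Qed.
HB.instance Definition _ := GRing.isZmodMorphism.Build
  (M X * N X)%type (M Y * N Y)%type nsum_fun nsum_fun_zmod_morphism.
Definition nsum_mor : {additive (M X * N X) -> (M Y * N Y)} := nsum_fun.
End Mor.

Lemma nsum_morD (X Y : C) (f g : hom X Y) x :
  nsum_mor (f + g) x = nsum_mor f x + nsum_mor g x.
Proof. by rewrite /= /nsum_fun !fmorD. Qed.
Lemma nsum_mor1 (X : C) x : nsum_mor (idm X) x = x.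
Proof. by case: x => x y; rewrite /= /nsum_fun !fmor1. Qed.
Lemma nsum_morM (X Y Z : C) (g : hom Y Z) (f : hom X Y) x :
  nsum_mor (ccomp g f) x = nsum_mor g (nsum_mor f x).
Proof. by rewrite /= /nsum_fun !fmorM. Qed.

Definition nsum : cmod C :=
  @CMod R C (fun X => (M X * N X)%type : zmodType) nsum_mor
    nsum_morD nsum_mor1 nsum_morM.
End Sum.

Section Power.
Variables (M : cmod C) (n : nat).

Section Mor.
Variables (X Y : C) (f : hom X Y).
Definition npow_fun (p : {ffun 'I_n -> M X}) : {ffun 'I_n -> M Y} :=
  [ffun i => fmor M f (p i)].
Lemma npow_fun_zmod_morphism : zmod_morphism npow_fun.
Proof. by move=> p q; apply/ffunP => i; rewrite !ffunE raddfB. Qed.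
HB.instance Definition _ := GRing.isZmodMorphism.Build
  {ffun 'I_n -> M X} {ffun 'I_n -> M Y} npow_fun npow_fun_zmod_morphism.
Definition npow_mor : {additive {ffun 'I_n -> M X} -> {ffun 'I_n -> M Y}} :=
  npow_fun.
End Mor.

Lemma npow_morD (X Y : C) (f g : hom X Y) x :
  npow_mor (f + g) x = npow_mor f x + npow_mor g x.
Proof. by apply/ffunP => i; rewrite !ffunE fmorD. Qed.
Lemma npow_mor1 (X : C) x : npow_mor (idm X) x = x.
Proof. by apply/ffunP => i; rewrite !ffunE fmor1. Qed.
Lemma npow_morM (X Y Z : C) (g : hom Y Z) (f : hom X Y) x :
  npow_mor (ccomp g f) x = npow_mor g (npow_mor f x).
Proof. by apply/ffunP => i; rewrite !ffunE fmorM. Qed.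

Definition npow : cmod C :=
  @CMod R C (fun X => {ffun 'I_n -> M X} : zmodType) npow_mor
    npow_morD npow_mor1 npow_morM.
End Power.

Definition in_add (M N : cmod C) : Prop :=
  exists (n : nat) (N' : cmod C), niso (nsum N N') (npow M n).

End DirectSums.

Section Subfunctors.
Variables (R : comPzRingType) (C : lincat R).

Record subfunctor (M : cmod C) := Subfunctor {
  spred :> forall X : C, {pred M X};
  spred_zmod_closed : forall X, zmod_closed (@spred X);
  spred_stable : forall (X Y : C) (f : hom X Y) x,
    x \in @spred X -> fmor M f x \in @spred Y
}.
Arguments spred {M} s X : rename.

Definition sub_le (M : cmod C) (S T : subfunctor M) : Prop :=
  forall X, {subset S X <= T X}.
Definition sub_full (M : cmod C) (S : subfunctor M) : Prop :=
  forall X x, x \in S X.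

Definition maximal_sub (M : cmod C) (S : subfunctor M) : Prop :=
  ~ sub_full S /\
  forall T : subfunctor M, sub_le S T -> sub_le T S \/ sub_full T.

Section Radical.
Variable M : cmod C.

Definition rad_pred (X : C) : {pred M X} :=
  [pred x | `[< forall S : subfunctor M, maximal_sub S -> x \in S X >]].
Arguments rad_pred : clear implicits.

Lemma rad_zmod_closed (X : C) : zmod_closed (rad_pred X).
Proof.
split=> [|u v].
  by rewrite inE; apply/asboolP => S _; case: (spred_zmod_closed S X).
rewrite !inE => /asboolP ru /asboolP rv; apply/asboolP => S mS.
by case: (spred_zmod_closed S X) => _; apply; [apply: ru|apply: rv].
Qed.

Lemma rad_stable (X Y : C) (f : hom X Y) x :
  x \in rad_pred X -> fmor M f x \in rad_pred Y.
Proof.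
rewrite !inE => /asboolP rx; apply/asboolP => S mS.
by apply: spred_stable; apply: rx.
Qed.

Definition nrad : subfunctor M := Subfunctor rad_zmod_closed rad_stable.
End Radical.

HB.instance Definition _ (M : cmod C) (S : subfunctor M) (X : C) :=
  GRing.isZmodClosed.Build (M X) (spred S X) (spred_zmod_closed S X).

Section Quotient.
Variables (M : cmod C) (S : subfunctor M).

Definition nquot_ob (X : C) : Type := Quotient.quot (spred S X).
HB.instance Definition _ X := GRing.Zmodule.on (nquot_ob X).

Definition nquot_pi X (x : M X) : nquot_ob X := \pi_(Quotient.quot (spred S X)) x.

Lemma nquot_piB X : {morph @nquot_pi X : x y / x - y}.
Proof. exact: (raddfB (\pi_(Quotient.quot (spred S X)))). Qed.

Lemma nquot_piD X : {morph @nquot_pi X : x y / x + y}.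
Proof. exact: (raddfD (\pi_(Quotient.quot (spred S X)))). Qed.

Lemma nquot_piP X (q : nquot_ob X) : exists x, q = nquot_pi x.
Proof.
exists (repr (q : Quotient.quot (spred S X))); rewrite /nquot_pi; exact/esym/reprK.
Qed.

Section Mor.
Variables (X Y : C) (f : hom X Y).
Definition nquot_fun (q : nquot_ob X) : nquot_ob Y :=
  nquot_pi (fmor M f (repr (q : Quotient.quot (spred S X)))).

Lemma nquot_funE x : nquot_fun (nquot_pi x) = nquot_pi (fmor M f x).
Proof.
apply/eqP; rewrite /nquot_fun /nquot_pi -Quotient.idealrBE -raddfB.
by apply: spred_stable; rewrite Quotient.idealrBE reprK.
Qed.

Lemma nquot_fun_zmod_morphism : zmod_morphism nquot_fun.
Proof.
move=> p q; case: (nquot_piP p) (nquot_piP q) => x -> [y ->].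
by rewrite -nquot_piB !nquot_funE raddfB nquot_piB.
Qed.
HB.instance Definition _ := GRing.isZmodMorphism.Build
  (nquot_ob X) (nquot_ob Y) nquot_fun nquot_fun_zmod_morphism.
Definition nquot_mor : {additive nquot_ob X -> nquot_ob Y} := nquot_fun.
End Mor.

Lemma nquot_morD (X Y : C) (f g : hom X Y) x :
  nquot_mor (f + g) x = nquot_mor f x + nquot_mor g x.
Proof.
by case: (nquot_piP x) => {}x ->; rewrite /= !nquot_funE fmorD nquot_piD.
Qed.
Lemma nquot_mor1 (X : C) x : nquot_mor (idm X) x = x.
Proof. by case: (nquot_piP x) => {}x ->; rewrite /= nquot_funE fmor1. Qed.
Lemma nquot_morM (X Y Z : C) (g : hom Y Z) (f : hom X Y) x :
  nquot_mor (ccomp g f) x = nquot_mor g (nquot_mor f x).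
Proof. by case: (nquot_piP x) => {}x ->; rewrite /= !nquot_funE fmorM. Qed.

Definition nquot : cmod C :=
  @CMod R C (fun X => nquot_ob X : zmodType) nquot_mor
    nquot_morD nquot_mor1 nquot_morM.
End Quotient.

End Subfunctors.

Section FinitelyPresented.
Variables (R : comPzRingType) (C : lincat R).
Implicit Types M N Y J : cmod C.

(* Finite direct sums of representables are representable over an additive C,
   so single representables suffice in a presentation. *)
Definition fin_pres M : Prop :=
  exists (X1 X0 : C) (a : natt (yon X1) (yon X0)) (p : natt (yon X0) M),
    nexact a p /\ nepi p.

Definition projective_cmod M : Prop :=
  forall (A B : cmod C) (p : natt A B) (g : natt M B),
    nepi p -> exists h : natt M A, natt_comp p h = g.

(* The next notions are relative to mod(C).  For C dualizing, mod(C) is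
   an abelian subcategory of Mod(C), so its monomorphisms and exact sequences
   are the pointwise ones. *)
Definition inj_fp J : Prop :=
  fin_pres J /\
  forall (A B : cmod C) (i : natt A B) (g : natt A J),
    fin_pres A -> fin_pres B -> nmono i ->
    exists h : natt B J, natt_comp h i = g.

Definition essential_fp M J (i : natt M J) : Prop :=
  nmono i /\
  forall (B : cmod C) (h : natt J B),
    fin_pres B -> nmono (natt_comp h i) -> nmono h.

Definition injective_envelope_fp M J : Prop :=
  inj_fp J /\ exists i : natt M J, essential_fp i.

(* I_k, with None standing for k = oo *)
Definition in_I J (k : option nat) Y : Prop :=
  fin_pres Y /\
  exists (K : nat -> cmod C) (e : natt Y (K 0%N))
         (d : forall i, natt (K i) (K i.+1)),
    [/\ forall i, inj_fp (K i),
        nmono e, nexact e (d 0%N), forall i, nexact (d i) (d i.+1) &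
        forall i, (if k is Some m then (i <= m)%N else true) -> in_add J (K i)].

End FinitelyPresented.

Section Dual.
Variables (R : comPzRingType) (E : lmodType R).

Section RModStructure.
Variables (C : lincat R) (M : cmod C) (X : C).

(* M(X) as an R-module: a acts through a *: id_X *)
Definition rval : Type := M X.
HB.instance Definition _ := GRing.Zmodule.on rval.

Definition rval_scale (a : R) (x : rval) : rval := fmor M (a *: idm X) x.

Let scaleA a b x : rval_scale a (rval_scale b x) = rval_scale (a * b) x.
Proof.
rewrite /rval_scale -fmorM; congr (fmor M _ x).
have cZ c (g : hom X X) : ccomp (c *: idm X) g = c *: g.
  by rewrite (scalable_linear (ccomp_linl g)) /= ccomp1m.
by rewrite cZ scalerA.
Qed.
Let scale1 : left_id 1 rval_scale.
Proof. by move=> x; rewrite /rval_scale scale1r fmor1. Qed.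
Let scaleDr : right_distributive rval_scale +%R.
Proof. by move=> a x y; rewrite /rval_scale raddfD. Qed.
Let scaleDl x : {morph rval_scale^~ x : a b / a + b}.
Proof. by move=> a b; rewrite /rval_scale scalerDl fmorD. Qed.

HB.instance Definition _ := GRing.Zmodule_isLmodule.Build R rval
  scaleA scale1 scaleDr scaleDl.

Definition rdual : Type := {linear rval -> E}.
HB.instance Definition _ := gen_eqMixin rdual.
HB.instance Definition _ := gen_choiceMixin rdual.

Lemma linear_eq (U V : lmodType R) (f g : {linear U -> V}) : f =1 g -> f = g.
Proof.
case: f g => [f [[hf] [kf]]] [g [[hg] [kg]]] /= /funext fg.
case: _ / fg hg kg => hg kg.
by rewrite (Prop_irrelevance hf hg) (Prop_irrelevance kf kg).
Qed.

Let dadd (f g : rdual) : rdual :=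
  (f : {linear rval -> E}) \+ (g : {linear rval -> E}).
Let dopp (f : rdual) : rdual := \- (f : {linear rval -> E}).
Let d0 : rdual := \0 : {linear rval -> E}.

Let daddA : associative dadd.
Proof. by move=> a b c; apply: linear_eq => x /=; rewrite addrA. Qed.
Let daddC : commutative dadd.
Proof. by move=> a b; apply: linear_eq => x /=; rewrite addrC. Qed.
Let dadd0 : left_id d0 dadd.
Proof. by move=> a; apply: linear_eq => x /=; rewrite add0r. Qed.
Let daddN : left_inverse d0 dopp dadd.
Proof. by move=> a; apply: linear_eq => x /=; rewrite addNr. Qed.

HB.instance Definition _ :=
  GRing.isZmodule.Build rdual daddA daddC dadd0 daddN.

End RModStructure.

Section DualFunctor.
Variables (C : lincat R) (M : cmod C).

Section Mor.
Variables (X Y : C) (f : hom Y X).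

Let res (x : rval M Y) : rval M X := fmor M f x.
Let res_linear : linear res.
Proof.
move=> a x y; rewrite /res raddfD; congr (_ + _).
have cf : ccomp f (a *: idm Y) = ccomp (a *: idm X) f.
  rewrite (scalable_linear (ccomp_linr f)) (scalable_linear (ccomp_linl f)) /=.
  by rewrite ccomp1m ccompm1.
have := congr1 (fun g => fmor M g (x : M Y)) cf.
by rewrite /= !fmorM.
Qed.
HB.instance Definition _ := GRing.isLinear.Build R _ _ _ res res_linear.

Definition dual_fun (phi : rdual M X) : rdual M Y :=
  (phi : {linear rval M X -> E}) \o res.

Lemma dual_funE phi (x : rval M Y) :
  (dual_fun phi : {linear rval M Y -> E}) x =
  (phi : {linear rval M X -> E}) (fmor M f x).
Proof. by []. Qed.

Lemma dual_fun_zmod_morphism : zmod_morphism dual_fun.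
Proof. by move=> a b; apply: linear_eq => x. Qed.
HB.instance Definition _ := GRing.isZmodMorphism.Build
  (rdual M X) (rdual M Y) dual_fun dual_fun_zmod_morphism.
Definition dual_mor : {additive rdual M X -> rdual M Y} := dual_fun.
End Mor.

Lemma dual_morD (X Y : opcat C) (f g : hom X Y) (phi : rdual M X) :
  dual_mor (f + g) phi = dual_mor f phi + dual_mor g phi.
Proof. by apply: linear_eq => x /=; rewrite /= fmorD raddfD. Qed.
Lemma dual_mor1 (X : opcat C) (phi : rdual M X) : dual_mor (idm X) phi = phi.
Proof. by apply: linear_eq => x /=; rewrite fmor1. Qed.
Lemma dual_morM (X Y Z : opcat C) (g : hom Y Z) (f : hom X Y) (phi : rdual M X) :
  dual_mor (ccomp g f) phi = dual_mor g (dual_mor f phi).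
Proof. by apply: linear_eq => x /=; rewrite fmorM. Qed.

Definition ndual : cmod (opcat C) :=
  @CMod R (opcat C) (fun X : C => rdual M X : zmodType) dual_mor
    dual_morD dual_mor1 dual_morM.

End DualFunctor.

Section DualMor.
Variables (C : lincat R) (M N : cmod C) (a : natt M N).

Section At.
Variable X : C.
Let aR (x : rval M X) : rval N X := a X x.
Let aR_linear : linear aR.
Proof.
by move=> c x y; rewrite /aR raddfD; congr (_ + _); apply: ntnat.
Qed.
HB.instance Definition _ := GRing.isLinear.Build R _ _ _ aR aR_linear.

Definition dualn_fun (phi : rdual N X) : rdual M X :=
  (phi : {linear rval N X -> E}) \o aR.
Lemma dualn_fun_zmod_morphism : zmod_morphism dualn_fun.
Proof. by move=> f g; apply: linear_eq => x. Qed.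
HB.instance Definition _ := GRing.isZmodMorphism.Build
  (rdual N X) (rdual M X) dualn_fun dualn_fun_zmod_morphism.
End At.

Definition ndual_mor : natt (ndual N) (ndual M).
Proof.
exists (fun X : C => @dualn_fun X : {additive rdual N X -> rdual M X}).
move=> X Y f phi; apply: linear_eq => x /=.
by congr ((phi : {linear rval N X -> E}) _); symmetry; apply: ntnat.
Defined.
End DualMor.

(* D_C restricts to a contravariant functor mod(C) -> mod(C^op) which is fully
   faithful and dense. *)
Definition dualizing (C : lincat R) : Prop :=
  [/\ hom_finite_variety C,
      forall M : cmod C, fin_pres M -> fin_pres (ndual M),
      forall M N : cmod C, fin_pres M -> fin_pres N -> bijective (@ndual_mor C M N) &
      forall N : cmod (opcat C), fin_pres N ->
        exists2 M : cmod C, fin_pres M & niso (ndual M) N].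

End Dual.

(* Main.v *)
From HB Require Import structures.
From mathcomp Require Import all_boot all_algebra.
From mathcomp Require Import boolp classical_sets.
Require Import Defs.

(** Write [P] for [yon X], [Gamma] for the endomorphisms of [X], and let
    Gamma-modules be modules under postcomposition, so that every [M X] and
    every [hom W X] is one.  Evaluation [M |-> M X] has the left adjoint
    [P (x) -] and the right adjoint, coinduction, that sends [N] to
    [W |-> Hom_Gamma (hom W X, N)].  Call [M] saturated when it is coinduced
    from [M X].

    The condition on [I_1] says that coinduction is exact.  The modules in
    [I_1] are the saturated finitely presented ones: [J] is saturated, so are
    kernels of maps between saturated modules, and conversely a finitely
    presented module without torsion (no nonzero element vanishing under every
    map to [X]) embeds in a power of [J], with a cokernel without torsion if
    the module is saturated ([torsionfree_embedding],
    [cokernel_torsionfree]).  A saturated module lies in [I_oo] as soon as all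
    the successive cokernels are again saturated.

    Coinduction is exact iff each [hom W X] is a projective Gamma-module, and
    this is the condition on tensor products, because by Yoneda they are
    [P (x) hom W X]:
    - if [P (x) hom W X] is projective, then Gamma-linear maps out of
      [hom W X] lift along epimorphisms ([equivariant_lift]), so cokernels of
      saturated modules are saturated and coresolutions in [add J] can be
      continued forever;
    - if [I_1 = I_oo], choose a map [f0 : W -> U] with [U] a power of [X]
      through which every map from [W] to [X] factors.  A coresolution in
      [add J] gives a Gamma-linear section of [hom U X -> hom W X]
      ([left_approximation_section]), which makes [P (x) hom W X] a retract of
      the representable of [U] ([section_tensor_projective]).

    That [J], the envelope of [P / rad P], plays the part of the coinduced
    injective cogenerator comes from the artinian ring [Gamma]: a proper left
    ideal annihilates a nonzero element of [Gamma / rad Gamma]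
    ([left_ideal_annihilator]), hence every nonzero element of [M X] is
    detected by a map from [M] to [J] ([envelope_cogenerates]).  The duality
    is used for the kernels of maps between finitely presented modules
    ([kernel_exists]) and for enough injectives. *)

Set Implicit Arguments.
Unset Strict Implicit.
Unset Printing Implicit Defensive.

Import GRing.Theory.
Local Open Scope ring_scope.

Lemma dchoice (T : Type) (U : T -> Type) (Q : forall t, U t -> Prop) :
  (forall t, exists u, Q t u) -> exists f : forall t, U t, forall t, Q t (f t).
Proof. by move=> h; exists (fun t => projT1 (cid (h t))) => t; case: cid. Qed.

(** * Natural transformations *)

Section MakeNatt.
Variables (R : comPzRingType) (C : lincat R) (M N : cmod C).
Variables (f : forall X : C, M X -> N X) (fB : forall X, zmod_morphism (@f X)).
Hypothesis fN : forall (X Y : C) (u : hom X Y) x,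
  f (fmor M u x) = fmor N u (f x).

HB.instance Definition _ X :=
  GRing.isZmodMorphism.Build (M X) (N X) (@f X) (fB (X := X)).

Definition mknatt : natt M N :=
  Natt (ntapp := fun X => @f X : {additive M X -> N X}) fN.
End MakeNatt.


Section Basics.
Variables (R : comPzRingType) (C : lincat R).
Implicit Types (M N K : cmod C) (U V W X Y B : C).

Lemma fmor0 M V W x : fmor M (0 : hom V W) x = 0.
Proof.
have := fmorD (c:=M) (0 : hom V W) 0 x; rewrite addr0 => e.
by apply: (@addrI _ (fmor M 0 x)); rewrite addr0 -e.
Qed.

Lemma fmorN M V W (f : hom V W) x : fmor M (- f) x = - fmor M f x.
Proof. by apply/eqP; rewrite -addr_eq0 -fmorD addNr fmor0. Qed.

Lemma fmorB M V W (f g : hom V W) x : fmor M (f - g) x = fmor M f x - fmor M g x.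
Proof. by rewrite fmorD fmorN. Qed.

Lemma fmor_sum M V W I (r : seq I) (F : I -> hom V W) x :
  fmor M (\sum_(i <- r) F i) x = \sum_(i <- r) fmor M (F i) x.
Proof.
by elim/big_rec2: _ => [|i y z _ <-]; rewrite ?fmor0 ?fmorD.
Qed.

Lemma ccompDl U V W (f g : hom V W) (h : hom U V) :
  ccomp (f + g) h = ccomp f h + ccomp g h.
Proof. exact: (@fmorD _ _ (yon U) _ _ f g h). Qed.

Lemma ccompDr U V W (h : hom V W) (f g : hom U V) :
  ccomp h (f + g) = ccomp h f + ccomp h g.
Proof. exact: (raddfD (fmor (yon U) h)). Qed.

Lemma ccomp0l U V W (h : hom U V) : ccomp (0 : hom V W) h = 0.
Proof. exact: (@fmor0 (yon U) _ _ h). Qed.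

Lemma ccomp0r U V W (h : hom V W) : ccomp h (0 : hom U V) = 0.
Proof. exact: (raddf0 (fmor (yon U) h)). Qed.

Lemma ccompBl U V W (f g : hom V W) (h : hom U V) :
  ccomp (f - g) h = ccomp f h - ccomp g h.
Proof. exact: (fmorB (M := yon U) f g h). Qed.

Lemma ccompBr U V W (h : hom V W) (f g : hom U V) :
  ccomp h (f - g) = ccomp h f - ccomp h g.
Proof. exact: (raddfB (fmor (yon U) h)). Qed.

Lemma ccompZl U V W c (f : hom V W) (h : hom U V) :
  ccomp (c *: f) h = c *: ccomp f h.
Proof. exact: (scalable_linear (ccomp_linl h)). Qed.

Lemma ccomp_suml U V W I (r : seq I) (F : I -> hom V W) (h : hom U V) :
  ccomp (\sum_(i <- r) F i) h = \sum_(i <- r) ccomp (F i) h.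
Proof. exact: (fmor_sum (M := yon U)). Qed.

Lemma ccomp_sumr U V W I (r : seq I) (F : I -> hom U V) (h : hom V W) :
  ccomp h (\sum_(i <- r) F i) = \sum_(i <- r) ccomp h (F i).
Proof. exact: (raddf_sum (fmor (yon U) h)). Qed.

Lemma ncompE K M N (b : natt M N) (a : natt K M) V x :
  natt_comp b a V x = b V (a V x).
Proof. by []. Qed.

Lemma biproduct_mul X Y B V W (i1 : hom X B) (i2 : hom Y B) p1 p2
    (z : hom X W) (w : hom Y W) (r : hom V X) (s : hom V Y) :
    ccomp p1 i1 = idm X -> ccomp p2 i2 = idm Y -> ccomp p1 i2 = 0 ->
    ccomp p2 i1 = 0 ->
  ccomp (ccomp z p1 + ccomp w p2) (ccomp i1 r + ccomp i2 s) =
  ccomp z r + ccomp w s.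
Proof.
move=> p11 p22 p12 p21; rewrite ccompDl !ccompDr -!ccompA.
rewrite !(ccompA p1) !(ccompA p2) p11 p22 p12 p21.
by rewrite !ccomp1m !ccomp0l !ccomp0r addr0 add0r.
Qed.

(** The natural transformation that the Yoneda lemma attaches to [m]. *)
Definition yel M W (m : M W) : natt (yon W) M.
Proof.
refine (@mknatt _ _ (yon W) M (fun V (g : yon W V) => fmor M g m) _ _).
- by move=> V g h /=; rewrite fmorB.
- by move=> V V' u g /=; rewrite fmorM.
Defined.

Lemma yelE M W (m : M W) V (g : hom W V) : yel m V g = fmor M g m.
Proof. by []. Qed.

Lemma natt_yon M W (a : natt (yon W) M) V (g : hom W V) :
  a V g = fmor M g (a W (idm W)).
Proof. by rewrite -ntnat /= /yon_fun ccompm1. Qed.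

Lemma yon_projective W : projective_cmod (yon W).
Proof.
move=> A B p g ep; have [a pa] := ep W (g W (idm W)).
exists (yel a); apply: natt_eq => V x.
by rewrite ncompE yelE ntnat pa -natt_yon.
Qed.

Lemma natt_factor_epi M N K (p : natt M N) (b : natt M K) : nepi p ->
    (forall V x, p V x = 0 -> b V x = 0) ->
  exists c : natt N K, forall V x, c V (p V x) = b V x.
Proof.
move=> ep pb.
have wd V x y : p V x = p V y -> b V x = b V y.
  move=> e; apply/eqP; rewrite -subr_eq0 -raddfB; apply/eqP/pb.
  by rewrite raddfB e subrr.
have exs : forall V, exists s : N V -> M V, cancel s (p V).
  by move=> V; have [s hs] := choice (ep V); exists s.
have {exs}[s hs] := dchoice exs.
have cE V x : b V (s V (p V x)) = b V x by apply: wd; rewrite hs.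
unshelve eexists.
  apply: (@mknatt _ _ N K (fun V x => b V (s V x))).
  - by move=> V x y; rewrite -raddfB; apply: wd; rewrite raddfB !hs.
  - by move=> V V' u x; rewrite -ntnat; apply: wd; rewrite ntnat !hs.
exact: cE.
Qed.

Lemma natt_factor_mono M N K (i : natt M N) (b : natt K N) : nmono i ->
    (forall V x, exists y, i V y = b V x) ->
  exists c : natt K M, forall V x, i V (c V x) = b V x.
Proof.
move=> mi ib.
have exs : forall V, exists s : K V -> M V, forall x, i V (s x) = b V x.
  by move=> V; have [s hs] := choice (ib V); exists s.
have {exs}[s hs] := dchoice exs.
unshelve eexists.
  apply: (@mknatt _ _ K M (fun V x => s V x)).
  - by move=> V x y; apply: (mi V); rewrite raddfB !hs raddfB.
  - by move=> V V' u x; apply: (mi V'); rewrite ntnat !hs ntnat.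
exact: hs.
Qed.

Lemma nmono0 M N (a : natt M N) : (forall V x, a V x = 0 -> x = 0) -> nmono a.
Proof.
move=> h V x y e; apply/eqP; rewrite -subr_eq0; apply/eqP/h.
by rewrite raddfB e subrr.
Qed.

Lemma natt_inj0 M N (a : natt M N) V x : nmono a -> a V x = 0 -> x = 0.
Proof. by move=> ma e; apply: (ma V); rewrite e raddf0. Qed.

Definition image_sub K M (k : natt K M) : subfunctor M.
Proof.
apply: (@Subfunctor _ _ M (fun V => [pred x | `[< exists y, k V y = x >]])).
- move=> V; split=> [|x y]; first by apply/asboolP; exists 0; rewrite raddf0.
  move=> /asboolP[u <-] /asboolP[v <-]; apply/asboolP.
  by exists (u - v); rewrite raddfB.
- move=> V W f x; move=> /asboolP[u <-]; apply/asboolP.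
  by exists (fmor K f u); rewrite ntnat.
Defined.

Definition quot_proj M (S : subfunctor M) : natt M (nquot S).
Proof.
apply: (@mknatt _ _ M (nquot S) (fun V x => nquot_pi S x)).
- by move=> V x y; rewrite nquot_piB.
- by move=> V W f x; rewrite /= nquot_funE.
Defined.

Lemma quot_proj_epi M (S : subfunctor M) : nepi (quot_proj S).
Proof. by move=> V y; have [x ->] := nquot_piP y; exists x. Qed.

Lemma quot_proj_eq0 M (S : subfunctor M) V x : quot_proj S V x = 0 <-> x \in S V.
Proof.
rewrite -[in X in _ <-> X](subr0 x) Quotient.idealrBE -(raddf0 (quot_proj S V)).
by split=> /eqP.
Qed.

Lemma nquot_pi_eq0 M (S : subfunctor M) V x :
  nquot_pi S x = 0 :> nquot S V <-> x \in S V.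
Proof. exact: quot_proj_eq0. Qed.

Lemma coker_exists K M (k : natt K M) :
  exists N (p : natt M N), nexact k p /\ nepi p.
Proof.
exists (nquot (image_sub k)), (quot_proj (image_sub k)).
split; last exact: quot_proj_epi.
move=> V x; split=> [/quot_proj_eq0/asboolP//|[y xy]].
by apply/quot_proj_eq0/asboolP; exists y.
Qed.

End Basics.

(** * Finitely presented modules *)

Section FinPres.
Variables (R : comPzRingType) (C : lincat R).
Implicit Types (M N K : cmod C) (U V W : C).

(** A presentation amounts to one generator [m] and one relation [r]: by
    Yoneda the maps out of representables are elements. *)
Lemma fin_presP M : fin_pres M <->
  exists X1 X0 (r : hom X0 X1) (m : M X0),
    (forall V (x : M V), exists g, fmor M g m = x) /\
    (forall V (g : hom X0 V), fmor M g m = 0 <-> exists h, ccomp h r = g).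
Proof.
split=> [[X1 [X0 [a [p [ap ep]]]]]|[X1 [X0 [r [m [gm rm]]]]]].
  exists X1, X0, (a X1 (idm X1)), (p X0 (idm X0)); split=> V x.
    by have [g pg] := ep V x; exists g; rewrite -natt_yon.
  rewrite -natt_yon; apply: iff_trans (ap V x) _.
  have aE h : a V h = ccomp h (a X1 (idm X1)) := natt_yon a h.
  by split=> -[h <-]; exists h; rewrite aE.
by exists X1, X0, (yel (M := yon X0) r), (yel m); split; [exact: rm|exact: gm].
Qed.

Lemma yon_fin_pres W : fin_pres (yon W).
Proof.
apply/fin_presP; exists W, W, 0, (idm W); split=> V g /=.
  by exists g; rewrite /= /yon_fun ccompm1.
rewrite /yon_fun ccompm1; split=> [->|[h <-]]; last by rewrite ccomp0r.
by exists 0; rewrite ccomp0r.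
Qed.

Lemma fin_pres_cover M : fin_pres M -> exists W (q : natt (yon W) M), nepi q.
Proof. by move=> [X1 [X0 [a [p [_ ep]]]]]; exists X0, p. Qed.

Hypothesis addC : additive_category C.

(** The relations of [N] are those of [M] together with a lift [x0] to the
    generators of [M] of the element that covers [K]. *)
Lemma fin_pres_coker K M N (k : natt K M) (p : natt M N) :
  nexact k p -> nepi p -> fin_pres K -> fin_pres M -> fin_pres N.
Proof.
move=> kp ep /fin_pres_cover[W [q eq_]] /fin_presP[X1 [X0 [r [m [gm rm]]]]].
have [x0 x0E] := gm W (k W (q W (idm W))).
have [B [i1 [i2 [p1 [p2 [p11 p22 p12 p21 ip]]]]]] := addC.2 X1 W.
apply/fin_presP; exists B, X0, (ccomp i1 r + ccomp i2 x0), (p X0 m); split=> V g.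
  have [x <-] := ep V g; have [h <-] := gm V x.
  by exists h; rewrite ntnat.
rewrite -ntnat; apply: iff_trans (kp V _) _.
have kE (w : hom W V) : k V (q V w) = fmor M (ccomp w x0) m.
  by rewrite natt_yon ntnat -x0E -fmorM.
split=> [[y]|[h <-]].
  have [w <-] := eq_ V y.
  rewrite kE => e; have /rm[z ez] : fmor M (g - ccomp w x0) m = 0.
    by rewrite fmorB e subrr.
  exists (ccomp z p1 + ccomp w p2).
  by rewrite (biproduct_mul _ _ _ _ p11 p22 p12 p21) ez subrK.
exists (q V (ccomp h i2)); rewrite kE ccompDr fmorD -ccompA.
have /rm -> : exists h', ccomp h' r = ccomp h (ccomp i1 r).
  by exists (ccomp h i1); rewrite ccompA.
by rewrite add0r.
Qed.

Lemma fin_pres_bij M N (p : natt M N) :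
  nmono p -> nepi p -> fin_pres M -> fin_pres N.
Proof.
move=> mp ep fM; apply: (@fin_pres_coker M M N 0 p) => // V x.
split=> [/(natt_inj0 mp) ->|[y <-]]; last by rewrite raddf0.
by exists 0; rewrite raddf0.
Qed.

Lemma fin_pres_sum M N : fin_pres M -> fin_pres N -> fin_pres (nsum M N).
Proof.
move=> /fin_presP[X1 [X0 [r [m [gm rm]]]]] /fin_presP[Y1 [Y0 [s [n [gn sn]]]]].
have [B [i1 [i2 [p1 [p2 [p11 p22 p12 p21 ip]]]]]] := addC.2 X0 Y0.
have [D [j1 [j2 [q1 [q2 [q11 q22 q12 q21 jq]]]]]] := addC.2 X1 Y1.
apply/fin_presP.
exists D, B, (ccomp (ccomp j1 r) p1 + ccomp (ccomp j2 s) p2).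
exists (fmor M i1 m, fmor N i2 n); split=> V.
  move=> [x y]; have [g gE] := gm V x; have [h hE] := gn V y.
  exists (ccomp g p1 + ccomp h p2); rewrite /= /nsum_fun /= -!fmorM.
  rewrite !ccompDl -!ccompA p11 p12 p21 p22 !ccompm1 !ccomp0r.
  by rewrite addr0 add0r gE hE.
move=> g; rewrite /= /nsum_fun /= -!fmorM; split=> [[/rm[h hE] /sn[k kE]]|[h <-]].
  exists (ccomp h q1 + ccomp k q2).
  rewrite -!(ccompA _ _ p1) -!(ccompA _ _ p2).
  rewrite (biproduct_mul _ _ _ _ q11 q22 q12 q21) !ccompA hE kE.
  by rewrite -!ccompA -ccompDr ip ccompm1.
have /rm -> : exists h', ccomp h' r =
    ccomp (ccomp h (ccomp (ccomp j1 r) p1 + ccomp (ccomp j2 s) p2)) i1.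
  exists (ccomp h j1).
  by rewrite -[RHS]ccompA ccompDl -!ccompA p11 p21 !ccompm1 !ccomp0r addr0.
have /sn -> // : exists h', ccomp h' s =
    ccomp (ccomp h (ccomp (ccomp j1 r) p1 + ccomp (ccomp j2 s) p2)) i2.
exists (ccomp h j2).
by rewrite -[RHS]ccompA ccompDl -!ccompA p12 p22 !ccompm1 !ccomp0r add0r.
Qed.

Lemma fin_pres_pow (X : C) M n : fin_pres M -> fin_pres (npow M n).
Proof.
move=> fM; elim: n => [|n IHn].
  apply/fin_presP; exists X, X, (idm X), 0; split=> V g.
    by exists 0; apply/ffunP => -[].
  by rewrite raddf0; split=> // _; exists g; rewrite ccompm1.
have fS := fin_pres_sum fM IHn.
pose cons V (x : nsum M (npow M n) V) : npow M n.+1 V :=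
  [ffun i => if unlift ord0 i is Some j then (x.2 : {ffun _ -> _}) j else x.1].
have consB V : zmod_morphism (@cons V).
  move=> x y; apply/ffunP => i; rewrite !ffunE /=.
  by case: unliftP => [j|] _; rewrite ?ffunE.
have consN (V W : C) (f : hom V W) x :
    cons W (fmor (nsum M (npow M n)) f x) = fmor (npow M n.+1) f (cons V x).
  by apply/ffunP => i; rewrite !ffunE /=; case: unliftP => [j|] _; rewrite ?ffunE.
apply: (@fin_pres_bij _ _ (mknatt consB consN)) fS.
  move=> V [x u] [y v] /ffunP /= e; congr (_, _).
    by have := e ord0; rewrite !ffunE unlift_none.
  by apply/ffunP => j; have := e (lift ord0 j); rewrite !ffunE liftK.
move=> V y; exists ((y : {ffun _ -> _}) ord0, [ffun j => (y : {ffun _ -> _}) (lift ord0 j)]).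
apply/ffunP => i; rewrite ffunE /=; case: unliftP => [j|] -> //.
by rewrite ffunE.
Qed.

End FinPres.

(** * Consequences of the duality *)

Lemma opcat_additive (R : comPzRingType) (C : lincat R) :
  additive_category C -> additive_category (opcat C).
Proof.
move=> [zC bC]; split=> [//|X Y].
have [W [i1 [i2 [p1 [p2 [p11 p22 p12 p21 ip]]]]]] := bC X Y.
by exists W, p1, p2, i1, i2.
Qed.

Section Dualizing.
Variables (R : comPzRingType) (E : lmodType R) (C : lincat R).
Hypothesis dC : dualizing E C.
Implicit Types (A B M N K : cmod C).

Let addC : additive_category C. Proof. by case: dC => -[]. Qed.
Let addCop : additive_category (opcat C). Proof. exact: opcat_additive. Qed.
Let fin_presD M : fin_pres M -> fin_pres (ndual E M).
Proof. by case: dC => _ + _ _; apply. Qed.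
Let dense (N : cmod (opcat C)) : fin_pres N ->
  exists2 M : cmod C, fin_pres M & niso (ndual E M) N.
Proof. by case: dC => _ _ _; apply. Qed.

Lemma ndual_full M N (b : natt (ndual E N) (ndual E M)) :
  fin_pres M -> fin_pres N -> exists a, ndual_mor E a = b.
Proof.
move=> fM fN; have [_ _ bij _] := dC; have [g _ gK] := bij _ _ fM fN.
by exists (g b).
Qed.

Lemma ndual_faithful M N (a b : natt M N) :
  fin_pres M -> fin_pres N -> ndual_mor E a = ndual_mor E b -> a = b.
Proof.
by move=> fM fN; have [_ _ bij _] := dC; have /bij_inj := bij _ _ fM fN; apply.
Qed.

Lemma ndual_comp M N K (b : natt N K) (a : natt M N) V phi :
  ndual_mor E (natt_comp b a) V phi = ndual_mor E a V (ndual_mor E b V phi).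
Proof. exact: linear_eq. Qed.

Lemma ndual0 M N V phi : ndual_mor E (0 : natt M N) V phi = 0.
Proof. by apply: linear_eq => x /=; rewrite raddf0. Qed.

(** An element in the kernel of [a] is a map from a representable that [a]
    kills; its dual vanishes if [ndual_mor E a] is epi, and the duality is
    faithful. *)
Lemma ndual_epi_mono M N (a : natt M N) :
  fin_pres M -> fin_pres N -> nepi (ndual_mor E a) -> nmono a.
Proof.
move=> fM fN ea; apply: nmono0 => V x ax.
suff e : yel x = 0 by rewrite -[x]fmor1 -yelE e.
apply: ndual_faithful (yon_fin_pres V) fM _; apply: natt_eq => W phi.
rewrite ndual0; have [psi <-] := ea W phi.
rewrite -ndual_comp -(ndual0 (yon V) psi); congr (ndual_mor E _ _ _).
by apply: natt_eq => U u; rewrite ncompE yelE ntnat ax raddf0.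
Qed.

(** The kernel is the module dual to the cokernel of the dual map.  Its
    exactness is tested on maps out of representables, the finitely presented
    modules that see elements. *)
Lemma kernel_exists A B (a : natt A B) : fin_pres A -> fin_pres B ->
  exists K (k : natt K A), [/\ fin_pres K, nmono k & nexact k a].
Proof.
move=> fA fB; have [Q [q [aq eq_]]] := coker_exists (ndual_mor E a).
have fQ := fin_pres_coker addCop aq eq_ (fin_presD fB) (fin_presD fA).
have [K fK [s [t [ts st]]]] := dense fQ.
have [k kE] := ndual_full (natt_comp t q) fK fA.
have tK V x : s V (t V x) = x by rewrite -ncompE st.
have sK V x : t V (s V x) = x by rewrite -ncompE ts.
have k0 V phi : ndual_mor E k V phi = t V (q V phi) by rewrite kE.
have ak : natt_comp a k = 0.
  apply: ndual_faithful => //; apply: natt_eq => V phi.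
  rewrite ndual_comp ndual0 k0 (_ : q V _ = 0) ?raddf0 //.
  by apply/aq; exists phi.
exists K, k; split=> //.
  apply: ndual_epi_mono => // V phi; have [psi qE] := eq_ V (s V phi).
  by exists psi; rewrite k0 qE sK.
move=> V x; split=> [ax|[y <-]]; last by rewrite -ncompE ak.
have [l lE] : exists l : natt Q (ndual E (yon V)),
    forall W phi, l W (q W phi) = ndual_mor E (yel x) W phi.
  apply: natt_factor_epi => // W phi /aq[psi <-].
  rewrite -ndual_comp -(ndual0 (yon V) psi); congr (ndual_mor E _ _ _).
  by apply: natt_eq => U u; rewrite ncompE yelE ntnat ax raddf0.
have [m mE] := ndual_full (natt_comp l s) (yon_fin_pres V) fK.
exists (m V (idm V)); rewrite -ncompE.
suff -> : natt_comp k m = yel x by rewrite yelE fmor1.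
apply: ndual_faithful (yon_fin_pres V) fA _; apply: natt_eq => W phi.
by rewrite ndual_comp mE ncompE k0 tK lE.
Qed.

Hypothesis injE : injective_module E.

Lemma ndual_mono_epi M N (a : natt M N) : nmono a -> nepi (ndual_mor E a).
Proof.
move=> ma V phi.
pose aV (x : rval M V) : rval N V := a V x.
have aV_linear : linear aV.
  by move=> c x y; rewrite /aV raddfD; congr (_ + _); apply: ntnat.
pose f : {linear rval M V -> rval N V} :=
  HB.pack aV (GRing.isLinear.Build R _ _ _ aV aV_linear).
have [psi psiE] := injE (phi : {linear rval M V -> E}) (ma V : injective f).
by exists (psi : rdual E N V); apply: linear_eq => x; apply: psiE.
Qed.

(** The dual of a lifting problem for a representable; the dual of a
    monomorphism is epi because [E] is injective. *)
Lemma dual_yon_inj_fp I (W : opcat C) :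
  fin_pres I -> niso (ndual E I) (yon W) -> inj_fp I.
Proof.
move=> fI [s [t [ts st]]]; split=> // A B i g fA fB mi.
have [h hE] := yon_projective (natt_comp (ndual_mor E g) t) (ndual_mono_epi mi).
have [u uE] := ndual_full (natt_comp h s) fB fI.
exists u; apply: ndual_faithful => //; apply: natt_eq => V phi.
rewrite ndual_comp uE -[LHS]/(natt_comp (ndual_mor E i) h V (s V phi)) hE.
by rewrite ncompE; congr (ndual_mor E g V _); rewrite -ncompE ts.
Qed.

(** Dualise a cover of the dual of [M] by a representable. *)
Lemma enough_injectives M : fin_pres M ->
  exists I (i : natt M I), inj_fp I /\ nmono i.
Proof.
move=> fM; have [W [q eq_]] := fin_pres_cover (fin_presD fM).
have [I fI Iiso] := dense (yon_fin_pres W).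
have [s [t [ts st]]] := Iiso.
have [i iE] := ndual_full (natt_comp q s) fM fI.
exists I, i; split; first exact: dual_yon_inj_fp Iiso.
apply: ndual_epi_mono => // V phi; have [x <-] := eq_ V phi.
by exists (t V x); rewrite iE ncompE -[s V _]ncompE st.
Qed.

(** Injectivity of [J], applied to the image of [a]: it is the cokernel of the
    kernel of [a], hence finitely presented. *)
Lemma inj_extend J A B (a : natt A B) (b : natt A J) :
    inj_fp J -> fin_pres A -> fin_pres B ->
    (forall V x, a V x = 0 -> b V x = 0) ->
  exists c : natt B J, forall V x, c V (a V x) = b V x.
Proof.
move=> iJ fA fB ab; have [K [k [fK mk ka]]] := kernel_exists a fA fB.
have [Q [q [kq eq_]]] := coker_exists k.
have fQ := fin_pres_coker addC kq eq_ fK fA.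
have [i iE] : exists i : natt Q B, forall V x, i V (q V x) = a V x.
  by apply: natt_factor_epi => // V x /kq /ka.
have [g gE] : exists g : natt Q J, forall V x, g V (q V x) = b V x.
  by apply: natt_factor_epi => // V x /kq /ka /ab.
have mi : nmono i.
  apply: nmono0 => V y; have [x <-] := eq_ V y.
  by rewrite iE => /ka /kq.
have [c cE] := iJ.2 _ _ i g fQ fB mi.
by exists c => V x; rewrite -iE -ncompE cE gE.
Qed.

End Dualizing.

(** * Descending chains *)

Section Artinian.
Variables (R : comPzRingType) (V : lmodType R).
Hypotheses (artR : artinian R) (fgV : fin_gen V).

(** The leading coefficients of the elements of [S] whose first [k]
    coordinates vanish form an ideal; these ideals, for [k] running over the
    generators, determine [S] within any larger submodule. *)
Lemma fin_gen_dcc (S : nat -> {pred V}) :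
    (forall n, submod_closed (S n)) -> (forall n, {subset S n.+1 <= S n}) ->
  exists n, forall m, (n <= m)%N -> {subset S n <= S m}.
Proof.
move=> cS dS; have [d [g gV]] := fgV.
pose lc (k : 'I_d) n : {pred R^o} := [pred c | `[< exists a : 'I_d -> R,
  [/\ forall j : 'I_d, (j < k)%N -> a j = 0, a k = c &
      \sum_(i < d) a i *: g i \in S n] >]].
have lc_closed k n : submod_closed (lc k n).
  have [S0 SD] := cS n; split.
    apply/asboolP; exists (fun=> 0); split=> //.
    by rewrite big1 // => i _; rewrite scale0r.
  move=> c x y /asboolP[a [a0 ak aS]] /asboolP[b [b0 bk bS]]; apply/asboolP.
  exists (fun i => c * a i + b i); split=> [j jk||].
  - by rewrite a0 // b0 // mulr0 addr0.
  - by rewrite ak bk.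
  under eq_bigr do rewrite scalerDl -scalerA.
  by rewrite big_split /= -scaler_sumr; apply: SD.
have SW n m : (n <= m)%N -> {subset S m <= S n}.
  elim: m => [|m IHm]; first by rewrite leqn0 => /eqP -> x.
  rewrite leq_eqVlt => /orP[/eqP -> x //|nm] x xS.
  by apply: IHm => //; apply: dS.
have /choice[N NE] k : exists n, forall m, (n <= m)%N -> lc k m =i lc k n.
  apply: artR => // n c /asboolP[a [a0 ak aS]]; apply/asboolP.
  by exists a; split=> //; apply: dS.
exists (\max_k N k) => m nm x xS; have [a aE] := gV x.
have [_ Sm] := cS m; have [_ Sn] := cS (\max_k N k).
have subS n (y z : V) : submod_closed (S n) -> y \in S n -> z \in S n -> y - z \in S n.
  by move=> [_ SD] yS zS; rewrite addrC -scaleN1r; apply: SD.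
suff /(_ d (leqnn d)) [b [bS b0]] : forall k, (k <= d)%N -> exists b : 'I_d -> R,
    x - \sum_(i < d) b i *: g i \in S m /\ forall j : 'I_d, (j < k)%N -> b j = 0.
  rewrite big1 ?subr0 // in bS => i _.
  by rewrite b0 ?scale0r.
elim=> [|k IHk] kd.
  exists a; split=> //; rewrite -aE subrr; by case: (cS m).
have [b [bS b0]] := IHk (ltnW kd).
pose k' := Ordinal kd.
(* The element with coordinates [b] stays in the larger submodule, so its
   leading coefficient is also one for the smaller submodule. *)
have xb : \sum_(i < d) b i *: g i \in S (\max_k N k).
  rewrite -[X in X \in _](subKr x); apply: subS => //.
  exact: SW nm _ bS.
have bm : b k' \in lc k' m.
  rewrite (NE k') ?(leq_trans (leq_bigmax k') nm) //.
  rewrite -(NE k' _ (leq_bigmax k')).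
  by apply/asboolP; exists b.
move/asboolP: bm => [c [c0 ck cS']].
exists (fun i => b i - c i); split=> [|j].
  under eq_bigr do rewrite scalerBl.
  by rewrite sumrB opprB addrA addrAC addrC -[X in X + _]scale1r; apply: Sm.
rewrite ltnS leq_eqVlt => /orP[/eqP jk|jk].
  by rewrite (_ : j = k') ?ck ?subrr //; apply: val_inj.
by rewrite b0 // c0 // subrr.
Qed.

(** Dependent choice turns the descending chain condition into the minimum
    condition. *)
Lemma fin_gen_min (F : {pred V} -> Prop) :
    (exists S, F S) -> (forall S, F S -> submod_closed S) ->
  exists2 S, F S & forall T, F T -> {subset T <= S} -> {subset S <= T}.
Proof.
move=> [S0 FS0] cF; apply: contrapT => noS.
have step (S : {S | F S}) : exists T : {S | F S},
    {subset sval T <= sval S} /\ ~ {subset sval S <= sval T}.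
  case: S => S FS; apply: contrapT => noT; apply: noS; exists S => // T FT TS.
  by apply: contrapT => nST; apply: noT; exists (exist _ T FT).
have [next nextP] := choice step.
pose S n := sval (iter n next (exist _ S0 FS0)).
have cS n : submod_closed (S n) by apply/cF/(svalP (iter n next _)).
have [n nP] := @fin_gen_dcc S cS (fun n => (nextP _).1).
exact: (nextP (iter n next (exist _ S0 FS0))).2 (nP n.+1 (leqnSn n)).
Qed.

End Artinian.

(** * The radical of a representable functor *)

Section Radical.
Variables (R : comPzRingType) (C : lincat R) (X : C).
Implicit Types (V W : C).

Lemma nradP (M : cmod C) V (x : M V) :
  reflect (forall S : subfunctor M, maximal_sub S -> x \in S V) (x \in nrad M V).
Proof. exact: asboolP. Qed.

Lemma sub_full_id (S : subfunctor (yon X)) : idm X \in S X -> sub_full S.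
Proof.
move=> S1 V x; have := spred_stable x S1.
by rewrite /= /yon_fun ccompm1.
Qed.

(** By maximality, the submodule generated by [S] and [x] is everything. *)
Lemma maximal_sub_unit (S : subfunctor (yon X)) W (x : hom X W) :
  maximal_sub S -> x \notin S W -> exists u, idm X - ccomp u x \in S X.
Proof.
move=> [_ mS] xS.
(* [T] is the sum of [S] and of the submodule generated by [x]. *)
pose T V : {pred yon X V} := [pred y | `[< exists u, y - ccomp u x \in S V >]].
have T_closed V : zmod_closed (T V).
  split=> [|y z].
    by apply/asboolP; exists 0; rewrite ccomp0l subrr; apply: rpred0.
  move=> /asboolP[u yu] /asboolP[v zv]; apply/asboolP; exists (u - v).
  by rewrite ccompBl opprD addrACA -opprD; apply: rpredB.
have T_stable V V' (f : hom V V') y :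
    y \in T V -> fmor (yon X) f y \in T V'.
  move=> /asboolP[u yu]; apply/asboolP; exists (ccomp f u).
  rewrite -ccompA -[ccomp f (ccomp u x)]/(fmor (yon X) f (ccomp u x)) -raddfB.
  exact: spred_stable.
have [V y yS||TT] := mS (Subfunctor T_closed T_stable).
- by apply/asboolP; exists 0; rewrite ccomp0l subr0.
- move=> TS; case/negP: xS; apply: TS; apply/asboolP; exists (idm W).
  by rewrite ccomp1m subrr; apply: rpred0.
- by have /asboolP[u] := TT X (idm X); exists u.
Qed.

Definition left_ideal (L : {pred hom X X}) : Prop :=
  submod_closed L /\ forall u x, x \in L -> ccomp u x \in L.

Lemma left_idealB L x y : left_ideal L -> x \in L -> y \in L -> x - y \in L.
Proof.
by move=> [[_ LD] _] xL yL; rewrite addrC -scaleN1r; apply: LD.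
Qed.

Lemma left_idealD L x y : left_ideal L -> x \in L -> y \in L -> x + y \in L.
Proof. by move=> [[_ LD] _] xL yL; rewrite -[x]scale1r; apply: LD. Qed.

Lemma sub_left_ideal (S : subfunctor (yon X)) : left_ideal (S X).
Proof.
have st u x : x \in S X -> ccomp u x \in S X by apply: (spred_stable u).
split=> //; split=> [|c x y xS yS]; first exact: rpred0.
by apply: rpredD => //; rewrite -[x]ccomp1m -ccompZl; apply: st.
Qed.

(** Zorn gives a maximal left ideal above [L]; the largest subfunctor with
    that value at [X] is maximal. *)
Lemma exists_maximal_sub L : left_ideal L -> idm X \notin L ->
  exists2 S : subfunctor (yon X), maximal_sub S & {subset L <= S X}.
Proof.
move=> LL L1.
(* Zorn is applied to subsets [A] through their unions with [L], so that the
   empty chain needs no upper bound other than the empty set. *)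
pose M (A : set (hom X X)) : {pred hom X X} := [pred x | `[< A x \/ x \in L >]].
pose Q A := left_ideal (M A) /\ idm X \notin M A.
have MP A x : reflect (A x \/ x \in L) (x \in M A) by apply: asboolP.
have LM A : {subset L <= M A} by move=> x xL; apply/MP; right.
have M0 : M set0 =i L by move=> x; apply/MP/idP => [[]|xL] //; right.
have [A [[AL A1] maxA]] : exists A, Q A /\ forall B, (A `<` B)%classic -> ~ Q B.
  apply: Zorn_bigcup => F FQ totF.
  have [[A0 FA0]|F0] := pselect (exists A, F A); last first.
    have U0 : (\bigcup_(A in F) A)%classic = set0.
      by rewrite -subset0 => x [A FA _]; apply: F0; exists A.
    rewrite U0 /Q M0; split=> //; split; first split=> [|c x y].
    - by rewrite M0; case: LL => -[].
    - by rewrite !M0; case: LL => -[_ LD] _; apply: LD.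
    - by move=> u x; rewrite !M0; case: LL => _; apply.
  pose U := (\bigcup_(A in F) A)%classic.
  have MU x : x \in M U -> exists2 A, F A & x \in M A.
    move=> /MP[[A FA Ax]|xL]; first by exists A => //; apply/MP; left.
    by exists A0 => //; apply: LM.
  have UM A x : F A -> x \in M A -> x \in M U.
    by move=> FA /MP[Ax|xL]; apply/MP; [left; exists A|right].
  have MS A B : (A `<=` B)%classic -> {subset M A <= M B}.
    by move=> AB x /MP[/AB Bx|xL]; apply/MP; [left|right].
  split; last by apply/negP => /MU[A /FQ[_ /negP]].
  split; first split=> [|c x y /MU[A FA Ax] /MU[B FB Bx]].
  - by apply: LM; case: LL => -[].
  - have [AB|BA] := totF _ _ FA FB.
      apply: (UM B) => //; have [[[_ BD] _] _] := FQ _ FB.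
      by apply: BD => //; apply: MS Ax.
    apply: (UM A) => //; have [[[_ AD] _] _] := FQ _ FA.
    by apply: AD => //; apply: MS Bx.
  - move=> u x /MU[A FA Ax]; apply: (UM A) => //.
    by have [[_ Ast] _] := FQ _ FA; apply: Ast.
pose S V : {pred yon X V} := [pred y | `[< forall u, ccomp u y \in M A >]].
have SP V y : reflect (forall u, ccomp u y \in M A) (y \in S V) by apply: asboolP.
have S_closed V : zmod_closed (S V).
  split=> [|y z /SP yS /SP zS]; apply/SP => u.
    by rewrite ccomp0r; case: AL => -[].
  rewrite ccompBr; exact: left_idealB.
have S_stable V W (f : hom V W) y : y \in S V -> fmor (yon X) f y \in S W.
  by move=> /SP yS; apply/SP => u; rewrite [X in X \in _]ccompA.
have MSub : {subset M A <= S X}.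
  by move=> x xA; apply/SP => u; case: AL => _; apply.
exists (Subfunctor S_closed S_stable); last by move=> x xL; apply/MSub/LM.
split=> [/(_ X (idm X))/SP/(_ (idm X))|T ST].
  by rewrite ccomp1m (negPf A1).
have [T1|T1] := boolP (idm X \in T X); first by right; apply: sub_full_id.
have MT : M (fun x => x \in T X) =i T X.
  move=> x; apply/MP/idP => [[//|xL]|]; last by left.
  by apply/ST/MSub/LM.
left=> V y yT; apply/SP => u; apply: contrapT => uyA.
have uyT : ccomp u y \in T X by apply: (spred_stable u).
apply: (maxA (fun x => x \in T X)).
  split=> [x Ax|/(_ _ uyT) Auy]; last by apply: uyA; apply/MP; left.
  by apply/ST/MSub/MP; left.
rewrite /Q MT; split=> //; have [[T0 TD] Tst] := sub_left_ideal T.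
by split; [split=> [|c x y']|move=> v x]; rewrite !MT //; [apply: TD|apply: Tst].
Qed.

Hypotheses (artR : artinian R) (fgX : fin_gen (hom X X)).

(** A proper left ideal of [End X] has a nonzero annihilator modulo the
    radical.  With [K] minimal among the left ideals such that [K + L]
    contains [1 = k + l], the intersection of [K] and [L] lies in the radical,
    and [x * k = x - x * l] belongs to it for every [x] in [L]. *)
Lemma left_ideal_annihilator L : left_ideal L -> idm X \notin L ->
  exists2 k : hom X X, k \notin nrad (yon X) X &
    forall x, x \in L -> ccomp x k \in nrad (yon X) X.
Proof.
move=> LL L1.
pose F (K : {pred hom X X}) := left_ideal K /\ exists2 k, k \in K & idm X - k \in L.
have [||K [LK [k kK kL]] minK] := fin_gen_min artR fgX (F := F).
- exists (fun=> true); split; first by [].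
  by exists (idm X) => //; rewrite subrr; case: LL => -[].
- by move=> K [[]].
(* If [1 - u x] lies in [S] and [x] does not, then [K] could be replaced by its
   intersection with [S], which contains [k (1 - u x)]. *)
have KL x : x \in K -> x \in L -> x \in nrad (yon X) X.
  move=> xK xL; apply/nradP => S mS; apply: contrapT => /negP xS.
  have [u uS] := maximal_sub_unit mS xS.
  have LS := sub_left_ideal S.
  case/negP: (xS); suff /minK : F (predI K (S X)).
    have sub : {subset predI K (S X) <= K} by move=> y /andP[].
    by move=> /(_ sub) /(_ x xK) /andP[].
  split.
    split; last by move=> v y /andP[yK yS]; apply/andP; split; [apply: LK.2|apply: LS.2].
    split; first by apply/andP; split; [apply: LK.1.1|apply: LS.1.1].
    move=> c y z /andP[yK yS] /andP[zK zS]; apply/andP.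
    by split; [apply: LK.1.2|apply: LS.1.2].
  exists (k - ccomp (ccomp k u) x).
    apply/andP; split; first by apply: left_idealB => //; apply: LK.2.
    have -> : k - ccomp (ccomp k u) x = ccomp k (idm X - ccomp u x).
      by rewrite ccompBr ccompm1 ccompA.
    exact: LS.2.
  by rewrite opprB addrA addrAC left_idealD //; apply: LL.2.
(* If [k] were in the radical, a maximal subfunctor above [L] would contain
   both [k] and [1 - k]. *)
exists k.
  have [S mS LS] := exists_maximal_sub LL L1.
  apply/negP => /nradP/(_ S mS) kS; case: mS => nS _; apply: nS.
  by apply: sub_full_id; rewrite -[idm X](subrK k); apply: rpredD => //; apply: LS.
move=> x xL; have xkE : ccomp x k = x - ccomp x (idm X - k).
  by rewrite ccompBr ccompm1 subKr.
apply: KL; first exact: LK.2.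
by rewrite xkE left_idealB //; apply: LL.2.
Qed.

End Radical.

(** * Modules determined by their value at [X] *)

Section Saturated.
Variables (R : comPzRingType) (C : lincat R) (X : C).
Implicit Types (V W : C) (M N K : cmod C).

(** Torsion-freeness for the torsion theory of the modules vanishing at
    [X]. *)
Definition torsionfree M : Prop :=
  forall W (m : M W), (forall f : hom W X, fmor M f m = 0) -> m = 0.

Definition equivariant M W (phi : hom W X -> M X) : Prop :=
  {morph phi : f g / f - g} /\ forall u f, phi (ccomp u f) = fmor M u (phi f).

(** [M] is saturated when [M W] is the group of [End X]-linear maps from
    [hom W X] to [M X], that is, when [M] is the coinduction of [M X]. *)
Definition saturated M : Prop :=
  torsionfree M /\
  forall W (phi : hom W X -> M X), equivariant phi ->
    exists m, forall f, phi f = fmor M f m.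

Lemma torsionfree_mono M N (a : natt M N) :
  nmono a -> torsionfree N -> torsionfree M.
Proof.
move=> ma tN W m m0; apply: (natt_inj0 ma); apply: tN => f.
by rewrite -ntnat m0 raddf0.
Qed.

Lemma equivariant_natt M N W (a : natt M N) (phi : hom W X -> M X) :
  equivariant phi -> equivariant (fun f => a X (phi f)).
Proof.
move=> [phiB phiM]; split=> [f g|u f]; first by rewrite phiB raddfB.
by rewrite phiM ntnat.
Qed.

Lemma saturated_retract M N (s : natt M N) (r : natt N M) :
  (forall V x, r V (s V x) = x) -> saturated N -> saturated M.
Proof.
move=> rs [tN gN]; have ms : nmono s by move=> V; apply: can_inj (rs V).
split=> [|W phi phiE]; first exact: torsionfree_mono ms tN.
have [m mE] := gN W _ (equivariant_natt s phiE).
by exists (r W m) => f; rewrite -ntnat -mE rs.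
Qed.

Lemma saturated_pow M n : saturated M -> saturated (npow M n).
Proof.
move=> [tM gM]; split=> [W m m0|W phi [phiB phiM]].
  apply/ffunP => i; rewrite [RHS]ffunE; apply: tM => f.
  by have /ffunP/(_ i) := m0 f; rewrite !ffunE.
have /choice[m mE] i : exists m, forall f,
    (phi f : {ffun 'I_n -> M X}) i = fmor M f m.
  apply: gM; split=> [f g|u f]; first by rewrite phiB !ffunE.
  by rewrite phiM /= ffunE.
by exists [ffun i => m i] => f; apply/ffunP => i; rewrite mE !ffunE.
Qed.

Lemma in_add_retract M N : in_add M N ->
  exists n (s : natt N (npow M n)) (r : natt (npow M n) N),
    forall V x, r V (s V x) = x.
Proof.
move=> [n [N' [a [b [ba _]]]]].
have sumB V : zmod_morphism (fun x : N V => (x, 0) : nsum N N' V).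
  by move=> x y; congr (_, _); rewrite subr0.
have sumN V W (u : hom V W) (x : N V) :
    (fmor N u x, 0) = fmor (nsum N N') u (x, 0) :> nsum N N' W.
  by rewrite /= /nsum_fun /= raddf0.
have fstB V : zmod_morphism (fun x : nsum N N' V => x.1) by [].
have fstN V W (u : hom V W) (x : nsum N N' V) :
  (fmor (nsum N N') u x).1 = fmor N u x.1 by [].
pose i : natt N (nsum N N') := mknatt sumB sumN.
pose p : natt (nsum N N') N := mknatt fstB fstN.
exists n, (natt_comp a i), (natt_comp p b) => V x.
by rewrite !ncompE -[b V _]ncompE ba.
Qed.

Lemma in_add_saturated M N : in_add M N -> saturated M -> saturated N.
Proof.
move=> /in_add_retract[n [s [r rs]]] sM.
by apply: saturated_retract rs _; apply: saturated_pow.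
Qed.

Lemma in_add_pow M n : in_add M (npow M n).
Proof.
exists n, (npow M 0).
have fstB V : zmod_morphism (fun x : nsum (npow M n) (npow M 0) V => x.1) by [].
have fstN V W (u : hom V W) (x : nsum (npow M n) (npow M 0) V) :
  (fmor (nsum (npow M n) (npow M 0)) u x).1 = fmor (npow M n) u x.1 by [].
have inB V : zmod_morphism
    (fun x : npow M n V => (x, 0) : nsum (npow M n) (npow M 0) V).
  by move=> x y; congr (_, _); rewrite subr0.
have inN V W (u : hom V W) (x : npow M n V) :
    (fmor (npow M n) u x, 0) =
    fmor (nsum (npow M n) (npow M 0)) u (x, 0) :> nsum (npow M n) (npow M 0) W.
  by rewrite /= /nsum_fun /= raddf0.
exists (mknatt fstB fstN), (mknatt inB inN); split; apply: natt_eq => V x //=.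
by case: x => x y; congr (_, _); apply/ffunP => -[].
Qed.

Lemma inj_fp_pow M n : additive_category C -> inj_fp M -> inj_fp (npow M n).
Proof.
move=> addC [fM iM]; split=> [|A B i g fA fB mi].
  exact: fin_pres_pow.
have projB j V : zmod_morphism (fun x : npow M n V => (x : {ffun _ -> _}) j).
  by move=> x y; rewrite !ffunE.
have projN j V W (u : hom V W) (x : npow M n V) :
    (fmor (npow M n) u x : {ffun _ -> _}) j = fmor M u ((x : {ffun _ -> _}) j).
  by rewrite ffunE.
have /choice[h hE] j := iM A B i (natt_comp (mknatt (projB j) (projN j)) g) fA fB mi.
have hB V : zmod_morphism (fun x : B V => [ffun j => h j V x] : npow M n V).
  by move=> x y; apply/ffunP => j; rewrite !ffunE raddfB.
have hN V W (u : hom V W) x : [ffun j => h j W (fmor B u x)] =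
    fmor (npow M n) u [ffun j => h j V x] :> npow M n W.
  by apply/ffunP => j; rewrite !ffunE ntnat.
exists (mknatt hB hN); apply: natt_eq => V x /=; apply/ffunP => j.
by rewrite ffunE -ncompE hE.
Qed.

(** The sum formula says that [U] is a summand of a power of [X]; [f0] gathers
    generators of [hom W X] over [R]. *)
Lemma left_approximation W : additive_category C -> fin_gen (hom W X) ->
  exists U n (i : 'I_n -> hom X U) (p : 'I_n -> hom U X) (f0 : hom W U),
    \sum_j ccomp (i j) (p j) = idm U /\
    forall f : hom W X, exists a, ccomp a f0 = f.
Proof.
move=> [[Z Z0] biC] [n [g gW]].
suff [U [i [p [f0 [ip f0g]]]]] :
    exists U (i : 'I_n -> hom X U) (p : 'I_n -> hom U X) (f0 : hom W U),
      \sum_j ccomp (i j) (p j) = idm U /\ forall j, exists a, ccomp a f0 = g j.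
  exists U, n, i, p, f0; split=> // f; have [c ->] := gW f.
  have [a aE] := choice f0g; exists (\sum_j c j *: a j).
  by rewrite ccomp_suml; apply: eq_bigr => j _; rewrite ccompZl aE.
elim: n g {gW} => [|n IHn] g.
  exists Z, (fun=> 0), (fun=> 0), 0; split=> [|[]//].
  by rewrite big_ord0 Z0.
have [U [i [p [f0 [ip f0g]]]]] := IHn (fun j => g (lift ord0 j)).
have [B [i1 [i2 [p1 [p2 [p11 p22 p12 p21 ipB]]]]]] := biC X U.
exists B, (fun j => if unlift ord0 j is Some k then ccomp i2 (i k) else i1).
exists (fun j => if unlift ord0 j is Some k then ccomp (p k) p2 else p1).
exists (ccomp i1 (g ord0) + ccomp i2 f0); split.
  rewrite big_ord_recl unlift_none -ipB; congr (_ + _).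
  under eq_bigr do rewrite liftK -ccompA (ccompA (i _)).
  by rewrite -ccomp_sumr -ccomp_suml ip ccomp1m.
move=> j; case: (unliftP ord0 j) => [k|] ->.
  have [a aE] := f0g k; exists (ccomp a p2).
  rewrite ccompDr -!ccompA (ccompA p2 i1) (ccompA p2 i2) p21 p22.
  by rewrite ccomp0l ccomp0r ccomp1m add0r.
exists p1; rewrite ccompDr !ccompA p11 p12.
by rewrite ccomp0l ccomp1m addr0.
Qed.

End Saturated.

(** * The injective envelope of the top of a representable *)

Section Envelope.
Variables (R : comPzRingType) (E : lmodType R) (C : lincat R) (X : C).
Hypotheses (artR : artinian R) (injE : injective_module E).
Hypothesis dC : dualizing E C.
Variable J : cmod C.
Hypothesis envJ : injective_envelope_fp (nquot (nrad (yon X))) J.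
Implicit Types (V W : C) (M N K : cmod C).

Let addC : additive_category C. Proof. by case: dC => -[]. Qed.
Let fg_hom V W : fin_gen (hom V W). Proof. by case: dC => -[]. Qed.
Let injJ : inj_fp J. Proof. by case: envJ. Qed.

(** The top of [yon X] is torsion-free: an element outside a maximal submodule
    generates, modulo that submodule, the identity of [X]. *)
Lemma nrad_local V (y : hom X V) : y \notin nrad (yon X) V ->
  exists u, ccomp u y \notin nrad (yon X) X.
Proof.
move=> yr; have [S [mS yS]] : exists S : subfunctor (yon X), maximal_sub S /\ y \notin S V.
  apply: contrapT => nS; case/negP: yr; apply/nradP => S mS.
  by apply: contrapT => /negP yS; apply: nS; exists S.
have [u uS] := maximal_sub_unit mS yS; exists u; apply/negP => /nradP/(_ S mS) uyS.
case: mS => nS _; apply: nS; apply: sub_full_id.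
by rewrite -[idm X](subrK (ccomp u y)); apply: rpredD.
Qed.

(** An element [m] of [J] that restricts to zero at [X] generates a submodule
    that vanishes at [X]; by [nrad_local] it meets the top of [yon X] in zero,
    so it is zero because the top is essential in [J]. *)
Lemma envelope_torsionfree : torsionfree X J.
Proof.
have [_ [i [mi ei]]] := envJ.
move=> W m m0; have [Q [q [mq eq_]]] := coker_exists (yel m).
have fQ := fin_pres_coker addC mq eq_ (yon_fin_pres W) injJ.1.
suff mq' : nmono q.
  apply: (natt_inj0 mq'); apply/mq; exists (idm W).
  by rewrite yelE fmor1.
apply: ei => //; apply: nmono0 => V y; have [{}y ->] := nquot_piP y.
rewrite ncompE => /mq[g gE].
apply/nquot_pi_eq0; apply: contrapT => /negP /nrad_local[u /negP[]].
apply/(@nquot_pi_eq0 _ _ (yon X)); apply: (natt_inj0 mi).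
transitivity (fmor J u (i V (nquot_pi (nrad (yon X)) y))).
  by rewrite -ntnat /= nquot_funE.
by rewrite -gE -ntnat yelE m0.
Qed.

(** The annihilator of [m] is a proper left ideal of [End X], so some element
    of the top of [yon X] is killed by it; sending [m] to that element defines
    a map on the submodule generated by [m], which extends to [M]. *)
Lemma envelope_cogenerates M (m : M X) : fin_pres M -> m <> 0 ->
  exists psi : natt M J, psi X m <> 0.
Proof.
move=> fM m0; have [_ [i [mi _]]] := envJ.
pose L : {pred hom X X} := [pred x | `[< fmor M x m = 0 >]].
have LL : left_ideal L.
  split; last first.
    by move=> u x /asboolP xm; apply/asboolP; rewrite fmorM xm raddf0.
  split=> [|c x y /asboolP xm /asboolP ym]; apply/asboolP; first exact: fmor0.
  rewrite fmorD ym addr0 -[x]ccomp1m -ccompZl fmorM xm raddf0 //.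
have L1 : idm X \notin L by apply/negP => /asboolP; rewrite fmor1.
have [k kr kL] := left_ideal_annihilator artR (fg_hom X X) LL L1.
pose j : J X := i X (nquot_pi (nrad (yon X)) k).
have jE V (f : hom X V) :
    fmor J f j = i V (nquot_pi (nrad (yon X)) (ccomp f k)).
  by rewrite -ntnat /= nquot_funE.
have [psi psiE] : exists psi : natt M J,
    forall V f, psi V (yel m V f) = yel j V f.
  apply: (inj_extend dC injJ (yon_fin_pres X) fM) => V f.
  rewrite !yelE => fm; apply: envelope_torsionfree => u.
  rewrite -fmorM jE (_ : nquot_pi _ _ = 0) ?raddf0 //.
  apply/nquot_pi_eq0/kL/asboolP.
  by rewrite fmorM fm raddf0.
exists psi => pm; case/negP: kr; apply/(@nquot_pi_eq0 _ _ (yon X)); apply: (natt_inj0 mi).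
have := psiE X (idm X); rewrite !yelE !fmor1 pm => /esym.
by [].
Qed.

Lemma fin_gen_rval M W : fin_pres M -> fin_gen (rval M W).
Proof.
move=> [X1 [X0 [_ [p [_ ep]]]]]; have [n [g gE]] := fg_hom X0 W.
exists n, (fun i => p W (g i) : rval M W) => x; have [f <-] := ep W x.
have [c ->] := gE f; exists c; rewrite raddf_sum; apply: eq_bigr => i _.
rewrite -[LHS]/(p W (c i *: g i)) -[g i in LHS]ccomp1m -ccompZl.
exact: (ntnat p (c i *: idm W) (g i)).
Qed.

(** Finitely many maps to [J] suffice, by the descending chain condition for
    the [R]-submodules of [M X]. *)
Lemma envelope_embedding M : fin_pres M ->
  exists n (a : natt M (npow J n)), forall x : M X, a X x = 0 -> x = 0.
Proof.
move=> fM.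
pose kers n (h : 'I_n -> natt M J) : {pred rval M X} :=
  [pred x : rval M X | `[< forall i, h i X x = 0 >]].
pose F (S : {pred rval M X}) := exists n (h : 'I_n -> natt M J), S = kers n h.
have [||_ [n [h ->]] minh] := fin_gen_min artR (fin_gen_rval X fM) (F := F).
- by exists (kers 0 (fun=> 0)), 0%N, (fun=> 0).
- move=> _ [n [h ->]]; split=> [|c x y /asboolP x0 /asboolP y0]; apply/asboolP => i.
    exact: (raddf0 (h i X)).
  rewrite (raddfD (h i X)) y0 addr0.
  rewrite -[LHS]/(h i X (fmor M (c *: idm X) x)) ntnat.
  by rewrite x0 raddf0.
have aB V : zmod_morphism (fun x : M V => [ffun i => h i V x] : npow J n V).
  by move=> x y; apply/ffunP => j; rewrite !ffunE raddfB.
have aN V W (u : hom V W) x : [ffun i => h i W (fmor M u x)] =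
    fmor (npow J n) u [ffun i => h i V x] :> npow J n W.
  by apply/ffunP => j; rewrite !ffunE ntnat.
exists n, (mknatt aB aN) => x /ffunP x0; apply: contrapT => /(envelope_cogenerates fM).
move=> [psi []].
pose h' (i : 'I_n.+1) := if unlift ord0 i is Some k then h k else psi.
have sub : {subset kers n.+1 h' <= kers n h}.
  move=> y /asboolP y0; apply/asboolP => i.
  by have := y0 (lift ord0 i); rewrite /h' liftK.
have Fh' : F (kers n.+1 h') by exists n.+1, h'.
have xh : (x : rval M X) \in kers n h.
  by apply/asboolP => i; have := x0 i; rewrite /= !ffunE.
have /asboolP/(_ ord0) := minh _ Fh' sub x xh.
by rewrite /h' unlift_none.
Qed.

Lemma torsionfree_embedding M : fin_pres M -> torsionfree X M ->
  exists n (a : natt M (npow J n)), nmono a.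
Proof.
move=> /envelope_embedding[n [a a0]] tM; exists n, a; apply: nmono0 => V x ax.
by apply: tM => f; apply: a0; rewrite ntnat ax raddf0.
Qed.

(** The values [phi (p j f0)] assemble to an element [j] of [J U].  The map
    from [yon U] that it defines vanishes on the kernel of composition with
    [f0], as [J] is torsion-free, hence extends along this composition. *)
Lemma envelope_saturated : saturated X J.
Proof.
split=> [|W phi [phiB phiM]]; first exact: envelope_torsionfree.
have phi0 : phi 0 = 0 by rewrite -[0 in LHS](subrr 0) phiB subrr.
have phiD f g : phi (f + g) = phi f + phi g.
  by rewrite -{1}[g]opprK -[- g]sub0r !phiB phi0 sub0r opprK.
have phi_sum n (f : 'I_n -> hom W X) : phi (\sum_j f j) = \sum_j phi (f j).
  exact: (big_morph phi phiD phi0).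
have [U [n [i [p [f0 [ip f0P]]]]]] := left_approximation addC (fg_hom W X).
pose j : J U := \sum_k fmor J (i k) (phi (ccomp (p k) f0)).
have jE (a : hom U X) : fmor J a j = phi (ccomp a f0).
  rewrite -[in RHS](ccompm1 a) -ip ccomp_sumr ccomp_suml phi_sum raddf_sum.
  by apply: eq_bigr => k _; rewrite -fmorM -phiM !ccompA.
have [c cE] : exists c : natt (yon W) J,
    forall V (f : hom U V), c V (yel (M := yon W) f0 V f) = yel j V f.
  apply: (inj_extend dC injJ (yon_fin_pres U) (yon_fin_pres W)) => V f.
  rewrite !yelE => ff0; apply: envelope_torsionfree => u.
  rewrite -fmorM jE -ccompA (_ : ccomp f f0 = 0) ?ccomp0r //; exact: ff0.
exists (c W (idm W)) => f; have [a <-] := f0P f.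
by rewrite -jE -natt_yon -[RHS]/(c X (yel (M := yon W) f0 X a)) cE.
Qed.

End Envelope.

(** * The tensor functor *)

Section TensorHom.
Variables (R : comPzRingType) (C : lincat R) (X W : C).
Implicit Types (A B M N : cmod C) (V : C).

Let T := ntensor (lhom (yon X) (yon W)).

(* By Yoneda, the second factor of the tensor product is [hom W X]. *)
Let tn V (x : hom X V) (f : hom W X) : T V :=
  tens (x : reval (yon X) V) (yel (M := yon W) f : lhom (yon X) (yon W)).

Let tnD V (x : hom X V) f g : tn x (f + g) = tn x f + tn x g.
Proof.
rewrite -tensDr; congr tens; apply: natt_eq => U u.
exact: (raddfD (fmor (yon W) u)).
Qed.

Let tn0 V (x : hom X V) : tn x 0 = 0.
Proof. by apply: (@addrI _ (tn x 0)); rewrite -tnD !addr0. Qed.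

Let tn_sum V (x : hom X V) n (f : 'I_n -> hom W X) :
  tn x (\sum_j f j) = \sum_j tn x (f j).
Proof. exact: (big_morph (tn x) (tnD x) (tn0 x)). Qed.

Let tnB V (x : hom X V) f g : tn x (f - g) = tn x f - tn x g.
Proof. by apply/eqP; rewrite eq_sym subr_eq -tnD subrK. Qed.

Let tnM V (x : hom X V) (a : hom X X) f : tn (ccomp x a) f = tn x (ccomp a f).
Proof.
pose s : endop (yon X) := yel (M := yon X) a.
rewrite -[tn (ccomp x a) f]/(tens ((s : (endop (yon X))^c) *: (x : reval (yon X) V)) _).
rewrite tensZ; congr tens; apply: natt_eq => U u.
exact: (esym (ccompA u a f)).
Qed.

Let tn_mor V V' (u : hom V V') (x : hom X V) f : fmor T u (tn x f) = tn (ccomp u x) f.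
Proof. exact: ften_morE. Qed.

Let tnE V (x : reval (yon X) V) (h : lhom (yon X) (yon W)) :
  tens x h = tn x ((h : natt (yon X) (yon W)) X (idm X)).
Proof.
by congr tens; apply: natt_eq => U u; exact: (natt_yon (h : natt _ _) u).
Qed.

(** The universal property of [T]: by Yoneda, [T] is the tensor product of
    [yon X] with the [End X]-module [hom W X]. *)
Lemma tensor_map_exists B (phi : hom W X -> B X) : equivariant phi ->
  exists g : natt T B, forall V (x : hom X V) f, g V (tn x f) = fmor B x (phi f).
Proof.
move=> [phiB phiM].
have phi0 : phi 0 = 0 by rewrite -[0 in LHS](subrr 0) phiB subrr.
have phiD f g : phi (f + g) = phi f + phi g.
  by rewrite -{1}[g]opprK -[- g]sub0r !phiB phi0 sub0r opprK.
pose b V (x : reval (yon X) V) (h : lhom (yon X) (yon W)) : B V :=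
  fmor B (x : hom X V) (phi ((h : natt (yon X) (yon W)) X (idm X))).
have bDl V x x' h : @b V (x + x') h = b V x h + b V x' h by apply: fmorD.
have bDr V x h h' : @b V x (h + h') = b V x h + b V x h'.
  by rewrite /b -raddfD -phiD.
have bZ V (s : endop (yon X)) x h :
    @b V ((s : (endop (yon X))^c) *: x) h = b V x (s *: h).
  rewrite /b (_ : ((s : (endop (yon X))^c) *: x) =
    ccomp x ((s : natt (yon X) (yon X)) X (idm X)) :> hom X V); last first.
    exact: (natt_yon (s : natt (yon X) (yon X)) x).
  rewrite fmorM -phiM; congr (fmor B _ (phi _)).
  exact: (esym (natt_yon (h : natt (yon X) (yon W)) _)).
pose g V : T V -> B V := tensor_lift (@bDl V) (@bDr V) (@bZ V).
have gE V x h : g V (tens x h) = b V x h by apply: tensor_liftE.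
have gB V : zmod_morphism (g V) by move=> x y; apply: raddfB.
have gN V V' (u : hom V V') x : g V' (fmor T u x) = fmor B u (g V x).
  apply: (tensor_ext (f := tensor_lift (@bDl V') (@bDr V') (@bZ V') \o fmor T u)
    (g := fmor B u \o tensor_lift (@bDl V) (@bDr V) (@bZ V))) => {}x h.
  rewrite -[LHS]/(g V' (fmor T u (tens x h))) -[RHS]/(fmor B u (g V (tens x h))).
  by rewrite ften_morE !gE /b -fmorM.
exists (mknatt gB gN) => V x f; rewrite [LHS]gE /b yelE.
by congr (fmor B _ (phi _)); apply: ccomp1m.
Qed.

Lemma equivariant_lift A B (p : natt A B) (phi : hom W X -> B X) :
    projective_cmod T -> nepi p -> equivariant phi ->
  exists psi : hom W X -> A X, equivariant psi /\ forall f, p X (psi f) = phi f.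
Proof.
move=> pT ep /tensor_map_exists[g gE]; have [h hE] := pT _ _ p g ep.
exists (fun f => h X (tn (idm X) f)); split=> [|f].
  split=> [f f'|u f]; first by rewrite tnB raddfB.
  by rewrite -ntnat tn_mor ccompm1 -[u in RHS]ccomp1m tnM.
by rewrite -ncompE hE gE fmor1.
Qed.

(** An [End X]-linear section [sigma] of composition with [f0] makes [T] a
    retract of [yon U]. *)
Lemma section_tensor_projective U n (i : 'I_n -> hom X U) (p : 'I_n -> hom U X)
    (f0 : hom W U) (sigma : hom W X -> yon U X) :
    \sum_j ccomp (i j) (p j) = idm U -> equivariant sigma ->
    (forall f, ccomp (sigma f) f0 = f) ->
  projective_cmod T.
Proof.
move=> ip /tensor_map_exists[s sE] sf0.
pose t : T U := \sum_j tn (i j) (ccomp (p j) f0).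
have rs V x : yel t V (s V x) = x.
  apply: (tensor_ext (f := yel t V \o s V) (g := idfun)) => {}x h.
  pose f : hom W X := (h : natt (yon X) (yon W)) X (idm X).
  rewrite tnE -[LHS]/(yel t V (s V (tn x f))) sE yelE.
  rewrite raddf_sum -[RHS]/(tn x f).
  under eq_bigr => j _ do rewrite tn_mor -ccompA tnM ccompA.
  rewrite -(tn_sum x) (_ : \sum_j _ = f) //.
  rewrite -ccomp_suml (_ : \sum_j _ = sigma f) ?sf0 //.
  by under eq_bigr do rewrite -ccompA; rewrite -ccomp_sumr ip ccompm1.
move=> A B q g eq_; have [h hE] := yon_projective (natt_comp g (yel t)) eq_.
exists (natt_comp h s); apply: natt_eq => V x.
by rewrite -[LHS]/(natt_comp q h V (s V x)) hE ncompE rs.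
Qed.

End TensorHom.

(** * Coresolutions *)

Section Coresolution.
Variables (R : comPzRingType) (C : lincat R).
Implicit Types (M K : cmod C).

(** Embeddings with controlled cokernels, chosen repeatedly, splice into a
    coresolution; the indices allow the first steps to differ from the rest. *)
Lemma coresolution (A B : nat -> cmod C -> Prop) :
    (forall i M, A i M -> exists K M' (e : natt M K) (p : natt K M'),
      [/\ nmono e, nexact e p, nepi p, B i K & A i.+1 M']) ->
  forall M, A 0 M ->
    exists (K : nat -> cmod C) (e : natt M (K 0)) (d : forall i, natt (K i) (K i.+1)),
      [/\ forall i, B i (K i), nmono e, nexact e (d 0) &
          forall i, nexact (d i) (d i.+1)].
Proof.
move=> step M0 A0.
pose St i := {M | A i M}.
pose D i (s : St i) :=
  {K : cmod C & {s' : St i.+1 & (natt (sval s) K * natt K (sval s'))%type}}.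
pose G (s : {i & St i}) (t : D _ (projT2 s)) :=
  let e := (projT2 (projT2 t)).1 in let p := (projT2 (projT2 t)).2 in
  [/\ nmono e, nexact e p, nepi p & B (projT1 s) (projT1 t)].
have ex s : exists t, @G s t.
  case: s => i [M AM]; have [K [M' [e [p [me ep ep' BK AM']]]]] := step i M AM.
  by exists (existT _ K (existT _ (exist _ M' AM') (e, p))).
have {ex step} [F FP] := dchoice ex.
pose next i (s : St i) : St i.+1 := projT1 (projT2 (F (existT _ i s))).
pose S : forall i, St i := nat_rect St (exist _ M0 A0) next.
pose FS i := F (existT _ i (S i)).
pose K i := projT1 (FS i).
pose e i : natt (sval (S i)) (K i) := (projT2 (projT2 (FS i))).1.
pose p i : natt (K i) (sval (S i.+1)) := (projT2 (projT2 (FS i))).2.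
have P i : [/\ nmono (e i), nexact (e i) (p i), nepi (p i) & B i (K i)].
  exact: FP (existT _ i (S i)).
have d_eq0 i V x : natt_comp (e i.+1) (p i) V x = 0 <-> p i V x = 0.
  have [me _ _ _] := P i.+1.
  by rewrite ncompE; split=> [/(natt_inj0 me)|->]; rewrite ?raddf0.
exists K, (e 0%N), (fun i => natt_comp (e i.+1) (p i)); split.
- by move=> i; have [] := P i.
- by have [] := P 0%N.
- move=> V x; apply: iff_trans (d_eq0 0%N V x) _.
  by have [_ ep _ _] := P 0%N; apply: ep.
- move=> i V x; apply: iff_trans (d_eq0 i.+1 V x) _.
  have [_ ep _ _] := P i.+1; apply: iff_trans (ep V x) _.
  have [_ _ epi_p _] := P i; split=> [[y <-]|[y <-]].
    by have [z <-] := epi_p V y; exists z.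
  by exists (p i V y).
Qed.

End Coresolution.

(** * The two implications *)

Section Saturation.
Variables (R : comPzRingType) (C : lincat R) (X : C).
Implicit Types (M K : cmod C).

Lemma kernel_saturated M K K' (e : natt M K) (d : natt K K') :
  nmono e -> nexact e d -> saturated X K -> torsionfree X K' -> saturated X M.
Proof.
move=> me ed [tK gK] tK'; split=> [|W phi phiE]; first exact: torsionfree_mono me tK.
have [z zE] := gK W _ (equivariant_natt e phiE).
have [m mE] : exists m, e W m = z.
  apply/ed/tK' => f; rewrite -ntnat -zE.
  by apply/ed; exists (phi f).
by exists m => f; apply: (me X); rewrite ntnat mE -zE.
Qed.

(** If [w] is torsion, then every restriction to [X] of a lift [v] comes from
    [M]; saturation assembles these into an element of [M] whose image is [v],
    as both have the same restrictions to [X]. *)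
Lemma cokernel_torsionfree M K K' (a : natt M K) (p : natt K K') :
    nmono a -> nexact a p -> nepi p -> saturated X M -> torsionfree X K ->
  torsionfree X K'.
Proof.
move=> ma ap ep [tM gM] tK W w w0; have [v vw] := ep W w.
have /choice[phi phiE] (f : hom W X) : exists x, a X x = fmor K f v.
  by apply/ap; rewrite ntnat vw w0.
have [x xE] : exists x, forall f, phi f = fmor M f x.
  apply: gM; split=> [f g|u f]; apply: (ma X).
    by rewrite raddfB !phiE fmorB.
  by rewrite ntnat !phiE fmorM.
rewrite -vw; apply/ap; exists x; apply/eqP; rewrite -subr_eq0; apply/eqP.
by apply: tK => f; rewrite raddfB -ntnat -xE phiE subrr.
Qed.

(** Coinduction from [End X] is exact when the modules [hom W X] are
    projective; by [equivariant_lift] it is enough that the tensor functors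
    are projective. *)
Lemma cokernel_saturated M K K' (a : natt M K) (p : natt K K') :
    (forall W, projective_cmod (ntensor (lhom (yon X) (yon W)))) ->
    nmono a -> nexact a p -> nepi p -> saturated X M -> saturated X K ->
  saturated X K'.
Proof.
move=> pT ma ap ep sM sK; split=> [|W phi phiE].
  exact: cokernel_torsionfree ap ep sM sK.1.
have [psi [psiE psiP]] := equivariant_lift (pT W) ep phiE.
have [m mE] := sK.2 W psi psiE.
by exists (p W m) => f; rewrite -ntnat -mE psiP.
Qed.

End Saturation.

Section Main.
Variables (R : comPzRingType) (E : lmodType R) (C : lincat R) (X : C).
Hypotheses (artR : artinian R) (injE : injective_module E).
Hypothesis dC : dualizing E C.
Variable J : cmod C.
Hypothesis envJ : injective_envelope_fp (nquot (nrad (yon X))) J.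
Implicit Types (V W : C) (M N K Y : cmod C).

Let addC : additive_category C. Proof. by case: dC => -[]. Qed.
Let fg_hom V W : fin_gen (hom V W). Proof. by case: dC => -[]. Qed.
Let injJ : inj_fp J. Proof. by case: envJ. Qed.
Let satJ : saturated X J. Proof. exact (envelope_saturated dC envJ). Qed.
Let injJn n : inj_fp (npow J n). Proof. exact: inj_fp_pow. Qed.

Lemma in_I1_saturated Y : in_I J (Some 1%N) Y -> saturated X Y.
Proof.
move=> [_ [K [e [d [_ me ed _ addK]]]]].
have sK i : (i <= 1)%N -> saturated X (K i).
  by move=> /addK aK; apply: in_add_saturated aK satJ.
by apply: kernel_saturated me ed (sK 0%N _) (sK 1%N _).1.
Qed.

Lemma saturated_in_I Y :
    (forall W, projective_cmod (ntensor (lhom (yon X) (yon W)))) ->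
  fin_pres Y -> saturated X Y -> in_I J None Y.
Proof.
move=> pT fY sY; split=> //.
pose A (i : nat) M := fin_pres M /\ saturated X M.
pose B (i : nat) K := inj_fp K /\ in_add J K.
have step i M : A i M -> exists K M' (e : natt M K) (p : natt K M'),
    [/\ nmono e, nexact e p, nepi p, B i K & A i.+1 M'].
  move=> [fM sM].
  have [n [e me]] := torsionfree_embedding artR dC envJ fM sM.1.
  have [M' [p [ep ep']]] := coker_exists e.
  exists (npow J n), M', e, p; split=> //; first by split=> //; apply: in_add_pow.
  split; first exact (fin_pres_coker addC ep ep' fM (injJn n).1).
  exact: cokernel_saturated pT me ep ep' sM (saturated_pow n satJ).
have [K [e [d [BK me ed dd]]]] := coresolution step (conj fY sY).
by exists K, e, d; split=> // i; have [] := BK i.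
Qed.

(** Only the first two terms are prescribed, the others come from enough
    injectives. *)
Lemma copresented_in_I1 Y n m (e : natt Y (npow J n))
    (d : natt (npow J n) (npow J m)) :
  fin_pres Y -> nmono e -> nexact e d -> in_I J (Some 1%N) Y.
Proof.
move=> fY me ed; split=> //.
pose A (i : nat) M := fin_pres M /\ match i with
  | 0 => exists n m (e : natt M (npow J n)) (d : natt (npow J n) (npow J m)),
      nmono e /\ nexact e d
  | 1 => exists m (e : natt M (npow J m)), nmono e
  | _ => True end.
pose B (i : nat) K := inj_fp K /\ ((i <= 1)%N -> in_add J K).
have step i M : A i M -> exists K M' (e : natt M K) (p : natt K M'),
    [/\ nmono e, nexact e p, nepi p, B i K & A i.+1 M'].
  case: i => [|[|i]] [fM].
  - move=> [n' [m' [e' [d' [me' ed']]]]].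
    have [M' [p [ep ep']]] := coker_exists e'.
    exists (npow J n'), M', e', p; split=> //; first by split=> // _; apply: in_add_pow.
    split; first exact (fin_pres_coker addC ep ep' fM (injJn n').1).
    have [g gE] : exists g : natt M' (npow J m'), forall V x, g V (p V x) = d' V x.
      by apply: natt_factor_epi => // V x /ep/ed'.
    exists m', g; apply: nmono0 => V y; have [x <-] := ep' V y.
    by rewrite gE => /ed'/ep.
  - move=> [m' [e' me']]; have [M' [p [ep ep']]] := coker_exists e'.
    exists (npow J m'), M', e', p; split=> //; first by split=> // _; apply: in_add_pow.
    by split=> //; exact (fin_pres_coker addC ep ep' fM (injJn m').1).
  - move=> _; have [I [e' [iI me']]] := enough_injectives dC injE fM.
    have [M' [p [ep ep']]] := coker_exists e'.
    exists I, M', e', p; split=> //.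
    by split=> //; exact (fin_pres_coker addC ep ep' fM iI.1).
have [|K [e' [d' [BK me' ed' dd']]]] := coresolution step (M := Y).
  by split=> //; exists n, m, e, d.
by exists K, e', d'; split=> // i; have [] := BK i.
Qed.

(** The reflection of [N] into the modules copresented by [J]: embed [N], up
    to torsion, in a power of [J], then the cokernel likewise; the kernel of
    the resulting map between powers of [J] agrees with [N] at [X]. *)
Lemma reflection_exists N : fin_pres N ->
  exists Y (a : natt N Y), [/\ in_I J (Some 1%N) Y, injective (a X) &
    forall y, exists x, a X x = y].
Proof.
move=> fN; have [n [h h0]] := envelope_embedding artR dC envJ fN.
have [Q [q [hq eq_]]] := coker_exists h.
have fQ := fin_pres_coker addC hq eq_ fN (injJn n).1.
have [m [g g0]] := envelope_embedding artR dC envJ fQ.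
pose d := natt_comp g q.
have [Y [y [fY my yd]]] := kernel_exists dC d (injJn n).1 (injJn m).1.
have [a aE] : exists a : natt N Y, forall V x, y V (a V x) = h V x.
  apply: natt_factor_mono => // V x; apply/yd.
  by rewrite ncompE (_ : q V _ = 0) ?raddf0 //; apply/hq; exists x.
have h_inj : injective (h X).
  move=> x x' e; apply/eqP; rewrite -subr_eq0; apply/eqP/h0.
  by rewrite raddfB e subrr.
exists Y, a; split; first exact: copresented_in_I1 fY my yd.
  by move=> x x' e; apply: h_inj; rewrite -!aE e.
move=> z; have [x xE] : exists x, h X x = y X z.
  by apply/hq/g0; rewrite -ncompE; apply/yd; exists z.
by exists x; apply: (my X); rewrite aE.
Qed.

(** Let [N] be the kernel of composition with [f0], [Y] its reflection and
    [K] a coresolution of [Y] by [add J].  At [X], composition with [f0] is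
    the pullback along some [hom W X -> K 1 X] of the projection of [K 0] onto
    the kernel of [K 1 -> K 2].  This kernel is saturated, so the map from
    [hom W X] comes from one element of it over [W], which lifts to
    [K 0 W]: this is where the exactness at [K 1] enters. *)
Lemma left_approximation_section W U (f0 : hom W U) :
    (forall Y, in_I J (Some 1%N) Y -> in_I J None Y) ->
    (forall f : hom W X, exists a, ccomp a f0 = f) ->
  exists sigma : hom W X -> yon U X, equivariant sigma /\
    forall f, ccomp (sigma f) f0 = f.
Proof.
move=> I1 f0P; pose a : natt (yon U) (yon W) := yel (M := yon W) f0.
have [N [k [fN mk ka]]] := kernel_exists dC a (yon_fin_pres U) (yon_fin_pres W).
have [Y [nu [IY nu_inj nu_surj]]] := reflection_exists fN.
have [fY [K [e [d [iK me ed dd addK]]]]] := I1 Y IY.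
have sK i : saturated X (K i) by apply: in_add_saturated (addK i isT) satJ.
have [b bE] := (iK 0%N).2 N (yon U) k (natt_comp e nu) fN (yon_fin_pres U) mk.
have bk V x : b V (k V x) = e V (nu V x) by rewrite -ncompE bE.
have ab V x : a V x = 0 -> d 0%N V (b V x) = 0.
  by move=> /ka[y <-]; rewrite bk; apply/ed; exists (nu V y).
have ab_eq V x y : a V x = a V y -> d 0%N V (b V x) = d 0%N V (b V y).
  move=> xy; apply/eqP; rewrite -subr_eq0 -!raddfB; apply/eqP/ab.
  by rewrite raddfB xy subrr.
have [s sE] := choice f0P.
have aM V V' (u : hom V V') x : a V' (fmor (yon U) u x) = ccomp u (a V x).
  exact: ntnat.
have aS f : a X (s f) = f by apply: sE.
pose phi f := d 0%N X (b X (s f)).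
have phiE : equivariant phi.
  split=> [f g|u f].
    by rewrite /phi -!raddfB; apply: ab_eq; rewrite raddfB !aS.
  by rewrite /phi -!ntnat; apply: ab_eq; rewrite aM !aS.
have [z zE] := (sK 1%N).2 W phi phiE.
have [z0 z0E] : exists z0, d 0%N W z0 = z.
  apply/dd; apply: (sK 2%N).1 => f; rewrite -ntnat -zE.
  by apply/dd; exists (b X (s f)).
have uniq_ab (x y : yon U X) : a X x = a X y -> b X x = b X y -> x = y.
  move=> axy bxy; apply/eqP; rewrite -subr_eq0; apply/eqP.
  have /ka[n nE] : a X (x - y) = 0 by rewrite raddfB axy subrr.
  rewrite -nE (_ : n = 0) ?raddf0 //; apply: nu_inj; apply: (me X).
  by rewrite -bk nE raddfB bxy subrr !raddf0.
have /choice[sigma sigmaE] (f : hom W X) : exists x : yon U X,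
    a X x = f /\ b X x = fmor (K 0%N) f z0.
  have /ed[y yE] : d 0%N X (b X (s f) - fmor (K 0%N) f z0) = 0.
    by rewrite raddfB ntnat z0E -zE subrr.
  have [n nE] := nu_surj y; exists (s f - k X n); split.
    rewrite raddfB aS (_ : a X (k X n) = 0) ?subr0 //.
    by apply/ka; exists n.
  by rewrite raddfB bk nE yE subKr.
exists sigma; split; last by move=> f; have [] := sigmaE f.
split=> [f g|u f]; apply: uniq_ab.
- by rewrite raddfB !(sigmaE _).1.
- by rewrite raddfB !(sigmaE _).2 fmorB.
- by rewrite aM !(sigmaE _).1.
- by rewrite ntnat !(sigmaE _).2 fmorM.
Qed.

End Main.

Theorem proposition8p11 (R : comPzRingType) (hR : artinian R)
    (E : lmodType R) (hE : injective_envelope (mod_top R^o) E)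
    (C : lincat R) (hC : dualizing E C) (X : C)
    (J : cmod C) (hJ : injective_envelope_fp (nquot (nrad (yon X))) J) :
  (forall Y : cmod C, in_I J (Some 1%N) Y <-> in_I J None Y)
  <->
  (forall X' : C, projective_cmod (ntensor (lhom (yon X) (yon X')))).
Proof.
have injE := hE.1; split=> [I1 W|pT Y].
  have [[addC _ fgC] _ _ _] := hC.
  have [U [n [i [p [f0 [ip f0P]]]]]] := left_approximation addC (fgC W X).
  have [sigma [sigmaE sf0]] :=
    left_approximation_section hR injE hC hJ (fun Y => (I1 Y).1) f0P.
  exact: section_tensor_projective ip sigmaE sf0.
split=> [IY|[fY [K [e [d [iK me ed dd aK]]]]]].
  exact (saturated_in_I hR hC hJ pT IY.1 (in_I1_saturated hC hJ IY)).
by split=> //; exists K, e, d; split=> // i _; apply: aK.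
Qed.
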